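(* Let $0<\alpha\le1$, let $\{\mathcal{S}^\alpha(t)\}_{t\ge0}$ be the generalized fractional Skellam process with rates $\lambda_j,\mu_j>0$, $j=1,\dots,k$, and let $\{D_f(t)\}_{t\ge0}$ be an independent Lévy subordinator with $\mathbb{E}(D_f^r(t))<\infty$ for all $r>0$. Let $\mathcal{Z}_f^\alpha(t)=\mathcal{S}^\alpha(D_f(t))$. Then for every integer $r\ge1$ the $r$th factorial moment $\Psi_f^\alpha(r,t)=\mathbb{E}\big(\mathcal{Z}_f^\alpha(t)(\mathcal{Z}_f^\alpha(t)-1)\cdots(\mathcal{Z}_f^\alpha(t)-r+1)\big)$ is given by $$\Psi_f^\alpha(r,t)=r!\sum_{n=1}^{r}\frac{\mathbb{E}\big((D_f(t))^{n\alpha}\big)}{\Gamma(n\alpha+1)}\sum_{\substack{m_1+\dots+m_n=r\\ m_i\in\mathbb{N}}}\ \prod_{l=1}^{n}\Big(\frac{1}{m_l!}\sum_{j=1}^{k}\big((j)_{m_l}\lambda_j+(-1)^{m_l}j^{(m_l)}\mu_j\big)\Big),$$ where $j^{(m)}=j(j+1)\cdots(j+m-1)$ and $(j)_m=j(j-1)\cdots(j-m+1)$ are the rising and falling factorials and $\mathbb{N}=\{1,2,\dots\}$.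
   Context: Fix an integer $k\ge1$ and positive rates $\lambda_1,\dots,\lambda_k,\mu_1,\dots,\mu_k$. The generalized counting process (GCP) with rates $\lambda_1,\dots,\lambda_k$ is a Lévy process started at $0$ performing jumps of size $j\in\{1,\dots,k\}$ at rate $\lambda_j$. The generalized Skellam process (GSP) is $\mathcal{S}(t)=M_1(t)-M_2(t)$, with $M_1,M_2$ independent GCPs with rates $\lambda_j$ and $\mu_j$, respectively. For $0<\alpha<1$, the inverse stable subordinator is $Y_\alpha(t)=\inf\{x\ge0: D_\alpha(x)>t\}$, where $D_\alpha$ is the stable subordinator, $\mathbb{E}(e^{-sD_\alpha(t)})=e^{-ts^\alpha}$. The generalized fractional Skellam process (GFSP) is $\mathcal{S}^\alpha(t)=\mathcal{S}(Y_\alpha(t))$ for $0<\alpha<1$ with $\mathcal{S}$ and $Y_\alpha$ independent, and $\mathcal{S}^1(t)=\mathcal{S}(t)$. A Lévy subordinator $\{D_f(t)\}_{t\ge0}$ is a one-dimensional Lévy process with non-decreasing sample paths, $D_f(0)=0$ a.s., and $\mathbb{E}(e^{-sD_f(t)})=e^{-tf(s)}$, $s>0$, where $f$ is its Bernštein function. The process $\mathcal{Z}_f^\alpha$ is called the time-changed generalized fractional Skellam process-I (TCGFSP-I). *)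

(* Defs.v *)
From HB Require Import structures.
From mathcomp Require Import all_boot all_order all_algebra.
From mathcomp Require Import all_classical all_reals all_analysis.

Set Implicit Arguments.
Unset Strict Implicit.
Unset Printing Implicit Defensive.

Import Order.TTheory GRing.Theory Num.Theory.
Import numFieldTopology.Exports numFieldNormedType.Exports.

Local Open Scope classical_set_scope.
Local Open Scope ring_scope.

(** A real-valued process on [T] is a function [X : R -> T -> R], [X t w] being
    its value at time [t]; only the times [t >= 0] are meaningful. *)

Section special_functions.
Context (R : realType).

Definition Gamma (a : R) : R :=
  \int[@lebesgue_measure R]_(x in `]0, +oo[) (x `^ (a - 1) * expR (- x)).

(** The falling factorial [(j)_m] of a natural number is MathComp's [j ^_ m]. *)
Definition rising_factorial (j m : nat) : nat := (\prod_(i < m) (j + i))%N.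

Definition real_falling_factorial (x : R) (r : nat) : R :=
  \prod_(i < r) (x - i%:R).

End special_functions.

Section processes.
Context d (T : measurableType d) (R : realType) (P : probability T R).
Implicit Types (X Y D M : R -> T -> R).

Definition is_process X : Prop :=
  forall t, 0 <= t -> measurable_fun [set: T] (X t).

Definition cadlag_paths X : Prop :=
  (forall w t, 0 <= t -> X ^~ w @ t^'+ --> X t w) /\
  (forall w t, 0 < t -> cvg (X ^~ w @ t^'-)).

(** Taking some of the [B i] to be [setT] gives the product rule for every
    subfamily of the increments. *)
Definition independent_increments X : Prop :=
  forall (n : nat) (t : nat -> R) (B : nat -> set R),
    0 <= t 0%N -> (forall i, t i <= t i.+1) -> (forall i, measurable (B i)) ->
    P [set w | forall i, (i < n)%N -> B i (X (t i.+1) w - X (t i) w)] =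
    (\prod_(i < n) P [set w | B i (X (t i.+1) w - X (t i) w)%R])%E.

Definition stationary_increments X : Prop :=
  forall (s h : R) (B : set R), 0 <= s -> 0 <= h -> measurable B ->
    P [set w | B (X (s + h) w - X s w)] = P [set w | B (X h w - X 0 w)].

(** Stochastic continuity is a consequence of right-continuity at [0] and
    stationarity of the increments. *)
Definition is_levy X : Prop :=
  [/\ is_process X, cadlag_paths X, {ae P, forall w, X 0 w = 0},
      independent_increments X & stationary_increments X].

Definition process_sigma_algebra X : set (set T) :=
  <<s [set A | exists (t : R) (B : set R),
         [/\ 0 <= t, measurable B & A = X t @^-1` B]] >>.

Definition independent_processes X Y : Prop :=
  forall A B : set T,
    process_sigma_algebra X A -> process_sigma_algebra Y B ->
    P (A `&` B) = (P A * P B)%E.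

(** Jumps of size [j] at rate [lambda_j]:
    [P(M(h) = j) = lambda_j h + o(h)] for [1 <= j <= k] and
    [P(M(h) = 0) = 1 - (lambda_1 + ... + lambda_k) h + o(h)] as [h -> 0+], so
    that any other value has probability [o(h)].
    The index [i : 'I_k] stands for the jump size [j = i.+1]. *)
Definition is_GCP (k : nat) (lambda : 'I_k -> R) M : Prop :=
  [/\ is_levy M,
      forall i : 'I_k,
        fine (P [set w | M h w = i.+1%:R]) / h @[h --> 0^'+] --> lambda i &
      (1 - fine (P [set w | M h w = 0])) / h @[h --> 0^'+]
        --> \sum_(i < k) lambda i].

Definition is_GSP (k : nat) (lambda mu : 'I_k -> R) X : Prop :=
  exists M1 M2 : R -> T -> R,
    [/\ is_GCP lambda M1, is_GCP mu M2, independent_processes M1 M2 &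
        forall t w, 0 <= t -> X t w = M1 t w - M2 t w].

(** [f] is the Laplace exponent (Bernstein function) of [D]. *)
Definition is_subordinator (f : R -> R) D : Prop :=
  [/\ is_levy D,
      forall w s t, 0 <= s -> s <= t -> D s w <= D t w &
      forall s t, 0 < s -> 0 <= t ->
        'E_P[fun w => expR (- s * D t w)]%E = (expR (- t * f s))%:E].

Definition is_stable_subordinator (alpha : R) D : Prop :=
  is_subordinator (fun s => s `^ alpha) D.

(** The set below is nonempty almost surely when [D] is a stable subordinator;
    otherwise [inf] takes the value [0]. *)
Definition inverse_process D : R -> T -> R :=
  fun t w => inf [set x : R | 0 <= x /\ t < D x w].

Definition time_change X D : R -> T -> R := fun t w => X (D t w) w.

(** For [alpha] in [(0, 1]], so that the [else] branch is the case [alpha = 1]. *)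
Definition is_GFSP (alpha : R) (k : nat) (lambda mu : 'I_k -> R) X : Prop :=
  if alpha < 1 then
    exists S D : R -> T -> R,
      [/\ is_GSP lambda mu S, is_stable_subordinator alpha D,
          independent_processes S (inverse_process D) &
          forall t w, 0 <= t -> X t w = time_change S (inverse_process D) t w]
  else is_GSP lambda mu X.

End processes.

(* Main.v *)
Require Import Defs.
From HB Require Import structures.
From mathcomp Require Import all_boot all_order all_algebra.
From mathcomp Require Import all_classical all_reals all_analysis.
From mathcomp Require Import measurable_realfun ring lra.
Import Order.TTheory GRing.Theory Num.Theory.
Import numFieldTopology.Exports numFieldNormedType.Exports.
Local Open Scope classical_set_scope.
Local Open Scope ring_scope.

(** Write [binom(x, r) = x (x - 1) ... (x - r + 1) / r!].

    Skellam process. Cut [0, t] into [n] steps. The rates determine, to first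
    order in [t / n], the generating polynomial [sum_i E binom(jump, i) z^i] of
    one step, truncated at degree [r]; by the Vandermonde identity the [n]-th
    power of that polynomial generates the binomial moments of the sum of the
    [n] independent jumps. In the limit [E binom(M t, r)] is the coefficient of
    [z^r] in [exp (t C(z))], where the coefficients of [C] are the inner sums of
    the theorem; a uniform second moment bound justifies the limit. Independence
    of [M1] and [M2] multiplies the exponentials.

    Inverse stable subordinator. Since [Y_t <= x] iff [D_x >= t] up to one value
    of [x], Tonelli gives the Laplace transform [m! s^(-m alpha - 1)] of
    [t |-> E Y_t^m]. Monotone functions with the same Laplace transform agree at
    continuity points, so [E Y_t^m = m! t^(m alpha) / Gamma (m alpha + 1)].

    Time changes. By Fubini, an independent random time replaces the [n]-th base
    function of time by its expectation, which applies first to [Y_t] and then to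
    [D_f]. The interchange is justified by the same formula with
    [|binom(., r)|], whose moments are dominated by those obtained after
    replacing [mu_j] by [(-1)^m mu_j] in the coefficient of order [m]. *)

(** * Generalized binomial coefficients *)

(** The definition of a counting process gives only infinitesimal rates: for each fixed h > 0 the
    variable M h may a priori take any real value, and no moment of M t is known beforehand. Moments
    are therefore computed for a substitute with finitely many values and transferred by a coupling.
    Binomial moments are used because division by r! turns the addition of independent variables
    into the multiplication of generating polynomials; the factor r! of the theorem undoes this
    normalisation. For a natural number m both binom(m, r) and (-1)^r binom(-m, r) are nonnegative,
    so absolute moments of a counting process cost only a sign, and the domination required by
    Fubini comes out of the same computation. Two more obstacles shape the end of the proof. The
    moments of Y_t are not known to be finite before their Laplace transform has been computed. A
    subordinator is nonnegative only almost surely, while processes are controlled only at times t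
    >= 0; hence random times appear as [Num.max (tau w) 0]. *)

Section gbinomial.
Context {R : realType}.
Implicit Types (x y : R) (m r : nat).

Definition gbinom x r : R := real_falling_factorial x r / r`!%:R.

Lemma fallingS x r :
  real_falling_factorial x r.+1 = real_falling_factorial x r * (x - r%:R).
Proof. by rewrite /real_falling_factorial big_ord_recr. Qed.

Lemma falling0 x : real_falling_factorial x 0 = 1.
Proof. by rewrite /real_falling_factorial big_ord0. Qed.

Lemma factr_neq0 r : (r`!%:R : R) != 0.
Proof. by rewrite pnatr_eq0 -lt0n fact_gt0. Qed.

Lemma gbinom0 x : gbinom x 0 = 1.
Proof. by rewrite /gbinom falling0 fact0 divr1. Qed.

Lemma gbinomS x r : (r.+1)%:R * gbinom x r.+1 = (x - r%:R) * gbinom x r.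
Proof.
rewrite /gbinom fallingS factS natrM.
have h1 := factr_neq0 r; have h2 : (r.+1%:R : R) != 0 by rewrite pnatr_eq0.
by field; rewrite h1 nat1r h2.
Qed.

Lemma gbinom_0S r : gbinom 0 r.+1 = 0.
Proof.
elim: r => [|r IH]; have := gbinomS 0 _.
  by move=> /(_ 0%N); rewrite subrr mul0r mul1r.
move=> /(_ r.+1); rewrite IH mulr0 => /eqP.
by rewrite mulf_eq0 pnatr_eq0 => /eqP.
Qed.

(** Vandermonde's identity at real arguments, by induction on r after multiplication by r + 1. *)
Lemma gbinomD x y r :
  gbinom (x + y) r = \sum_(i < r.+1) gbinom x i * gbinom y (r - i).
Proof.
elim: r => [|r IH]; first by rewrite big_ord1 !gbinom0 mulr1.
have h2 : (r.+1%:R : R) != 0 by rewrite pnatr_eq0.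
apply: (mulfI h2); rewrite gbinomS IH mulr_sumr.
(* The factor x + y - r is split as (x - i) + (y - (r - i)); [gbinomS] absorbs each part. *)
transitivity (\sum_(i < r.+1) (i.+1%:R * gbinom x i.+1 * gbinom y (r - i)) +
   \sum_(i < r.+1) (gbinom x i * ((r - i).+1%:R * gbinom y (r - i).+1))).
  rewrite -big_split; apply: eq_bigr => i _ /=.
  rewrite !gbinomS natrB; last by rewrite -ltnS.
  by ring.
rewrite mulr_sumr.
(* Both sums are extended by a term of weight 0, after which the weights i and r + 1 - i add up to r
   + 1. *)
transitivity (\sum_(i < r.+2) (i%:R * gbinom x i * gbinom y (r.+1 - i)) +
   \sum_(i < r.+2) (gbinom x i * ((r.+1 - i)%:R * gbinom y (r.+1 - i)))).
  congr (_ + _).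
    by rewrite [RHS]big_ord_recl/= !mul0r add0r; apply: eq_bigr.
  rewrite [RHS]big_ord_recr/= subnn mul0r mulr0 addr0; apply: eq_bigr => i _.
  by rewrite subSn // -ltnS.
rewrite -big_split; apply: eq_bigr => i _ /=.
rewrite natrB; last by rewrite -ltnS.
by ring.
Qed.

Lemma falling_nat (j m : nat) :
  real_falling_factorial (j%:R : R) m = (j ^_ m)%:R.
Proof.
elim: m => [|m IH]; first by rewrite falling0 ffactn0.
rewrite fallingS IH ffactnSr natrM; case: (leqP m j) => h; first by rewrite natrB.
by rewrite ffact_small// !mul0r.
Qed.

Lemma falling_opp_nat (j m : nat) :
  real_falling_factorial (- (j%:R) : R) m =
  (-1) ^+ m * (rising_factorial j m)%:R.
Proof.
elim: m => [|m IH]; first by rewrite falling0 /rising_factorial big_ord0 expr0 mulr1.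
rewrite fallingS IH /rising_factorial big_ord_recr/= natrM natrD exprS.
by ring.
Qed.

Lemma rising_ffact (j m : nat) : rising_factorial j m = ((j + m).-1 ^_ m)%N.
Proof.
elim: m j => [|m IH] j; first by rewrite /rising_factorial big_ord0 ffactn0.
by rewrite addnS ffactnS -IH /rising_factorial big_ord_recr/= mulnC.
Qed.

End gbinomial.

(** * Generating polynomials of binomial moments *)

Section gbinom_generating.
Context {R : realType} (r : nat).

Definition gbinom_poly (x : R) : {poly R} := \poly_(i < r.+1) gbinom x i.

(** A product of truncated series has terms of degree above r that are not binomial coefficients;
    constraining only the coefficients up to r makes the notion stable under products. *)
Definition is_gbinom_poly (p : {poly R}) (x : R) :=
  forall i, (i <= r)%N -> p`_i = gbinom x i.

Lemma gbinom_polyP x : is_gbinom_poly (gbinom_poly x) x.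
Proof. by move=> i ir; rewrite coef_poly ltnS ir. Qed.

Lemma is_gbinom_poly_prod (I : Type) (s : seq I) (p : I -> {poly R}) (x : I -> R) :
  (forall i, is_gbinom_poly (p i) (x i)) ->
  is_gbinom_poly (\prod_(i <- s) p i) (\sum_(i <- s) x i).
Proof.
move=> h; elim/big_rec2: _ => [|i y q _ hq] j jr.
  by case: j jr => [|j] jr; rewrite coef1/= ?gbinom0 ?gbinom_0S.
rewrite coefM gbinomD; apply: eq_bigr => l _.
rewrite h ?hq//; first by rewrite (leq_trans _ jr)// leq_subr.
by rewrite (leq_trans _ jr)// -ltnS.
Qed.

(* Both sides compute the [i]-th generalized binomial moment of a sum of [n]
   independent copies of a variable with finite law [w]. *)
Lemma coef_exp_gbinom_poly (V : finType) (w : V -> R) (x : V -> R) (n i : nat) :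
  (i <= r)%N ->
  ((\sum_v w v *: gbinom_poly (x v)) ^+ n)`_i =
  \sum_(v : {ffun 'I_n -> V}) (\prod_l w (v l)) * gbinom (\sum_l x (v l)) i.
Proof.
move=> ir; rewrite -[n in LHS]card_ord -prodr_const.
rewrite bigA_distr_bigA/= coef_sum; apply: eq_bigr => v _.
rewrite -(is_gbinom_poly_prod _ _ (fun l => gbinom_poly (x (v l))) (fun l => x (v l))) //;
  last by move=> l; exact: gbinom_polyP.
by rewrite scaler_prod coefZ.
Qed.

End gbinom_generating.

(** * Coefficientwise limits and exponentials of polynomials *)

Section poly_convergence.
Context {R : realType} (r : nat).
Implicit Types (A B : nat -> {poly R}) (C D : {poly R}).

Definition poly_cvg A C :=
  forall i, (i <= r)%N -> (A n)`_i @[n --> \oo] --> C`_i.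

Lemma poly_cvg_cst C : poly_cvg (fun=> C) C.
Proof. by move=> i _; exact: cvg_cst. Qed.

Lemma poly_cvgM A B C D :
  poly_cvg A C -> poly_cvg B D -> poly_cvg (fun n => A n * B n) (C * D).
Proof.
move=> h1 h2 i ir; under eq_fun do rewrite coefM; rewrite coefM.
apply: cvg_big; [exact: add_continuous|] => j _; apply: cvgM; [apply: h1|apply: h2].
  by rewrite (leq_trans _ ir)// -ltnS.
by rewrite (leq_trans _ ir)// leq_subr.
Qed.

Lemma poly_cvgX A C m : poly_cvg A C -> poly_cvg (fun n => A n ^+ m) (C ^+ m).
Proof.
move=> h; elim: m => [|m IH]; first exact: poly_cvg_cst.
rewrite exprS (_ : (fun _ => _) = (fun n => A n * A n ^+ m)); last first.
  by apply/funext => n; rewrite exprS.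
exact: poly_cvgM.
Qed.

Lemma binomial_scaled_cvg m :
  ('C(n.+1, m)%:R / (n.+1%:R ^+ m) : R) @[n --> \oo] --> (m`!%:R^-1 : R).
Proof.
have -> : (fun n => 'C(n.+1, m)%:R / (n.+1%:R ^+ m)) =
    (fun n => m`!%:R^-1 * (real_falling_factorial (n.+1%:R : R) m / (n.+1%:R ^+ m))).
  apply/funext => n; rewrite falling_nat -bin_ffact natrM mulrA; congr (_ / _).
  by rewrite mulrC mulfK// factr_neq0.
rewrite -[X in _ --> X]mulr1; apply: cvgM; first exact: cvg_cst.
elim: m => [|m IH].
  by under eq_fun do rewrite falling0 expr0 divr1; exact: cvg_cst.
(* The additional factor is (n + 1 - m) / (n + 1), which tends to 1. *)
have -> : (fun n => real_falling_factorial (n.+1%:R : R) m.+1 / n.+1%:R ^+ m.+1) =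
   (fun n => (real_falling_factorial (n.+1%:R : R) m / n.+1%:R ^+ m) *
     (1 - m%:R * harmonic n)).
  apply/funext => n; rewrite fallingS exprS /harmonic.
  have h2 : (n.+1%:R : R) != 0 by rewrite pnatr_eq0.
  have h3 : (n.+1%:R : R) ^+ m != 0 by rewrite expf_neq0.
  rewrite /=; move: (real_falling_factorial _ _) => z; move: (n.+1%:R : R) h2 h3 => x x0.
  move: (x ^+ m) => y y0.
  by field; rewrite y0 x0.
rewrite -[X in _ --> X]mulr1; apply: cvgM => //.
rewrite -[X in _ --> X]subr0; apply: cvgB; first exact: cvg_cst.
rewrite -[X in _ --> X](mulr0 m%:R); apply: cvgM; first exact: cvg_cst.
exact: cvg_harmonic.
Qed.

(** A polynomial without constant term is divisible by 'X, so its m-th power is divisible by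
    'X^m. *)
Lemma coef_exp_lt (p : {poly R}) m i : p`_0 = 0 -> (i < m)%N -> (p ^+ m)`_i = 0.
Proof.
move=> p0; elim: m i => // m IH i im; rewrite exprS coefM big1// => j _.
case: (posnP j) => [->|j0]; first by rewrite p0 mul0r.
rewrite IH ?mulr0//; case: j j0 => j /= jm j0.
by rewrite ltn_subLR ?(leq_trans im)//; case: j j0 jm => // j _ _; rewrite ltnS leq_addl.
Qed.

(** When C has no constant term this is the coefficient of z^i in exp (C(z)): the powers m > i do
    not reach degree i, so the series is a finite sum. *)
Definition exp_coef (C : {poly R}) (i : nat) : R :=
  \sum_(m < i.+1) m`!%:R^-1 * (C ^+ m)`_i.

(** A polynomial form of (1 + C / n)^n -> exp C. With A n = 1 + E n the binomial theorem applies,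
    and since E n has no constant term only the powers m <= i count: the number of terms stays fixed
    while n grows. *)
Lemma exp_coef_limit A C :
  (forall n, (A n)`_0 = 1) -> C`_0 = 0 ->
  (forall i, (0 < i <= r)%N -> n.+1%:R * (A n)`_i @[n --> \oo] --> C`_i) ->
  forall i, (i <= r)%N -> (A n ^+ n.+1)`_i @[n --> \oo] --> exp_coef C i.
Proof.
move=> A0 C0 AC i ir.
pose E (n : nat) : {poly R} := A n - 1.
have E0 n : (E n)`_0 = 0 by rewrite coefB A0 coef1 subrr.
have EC : poly_cvg (fun n => n.+1%:R *: E n) C.
  move=> j jr; case: (posnP j) => [->|j0].
    rewrite C0; under eq_fun do rewrite coefZ E0 mulr0; exact: cvg_cst.
  under eq_fun do rewrite coefZ coefB coef1 gtn_eqF// subr0.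
  by apply: AC; rewrite j0.
have -> : (fun n => (A n ^+ n.+1)`_i) = (fun n =>
    \sum_(m < i.+1) ('C(n.+1, m)%:R / (n.+1%:R ^+ m)) * ((n.+1%:R *: E n) ^+ m)`_i).
  apply/funext => n.
  have -> : A n = (1 : {poly R}) + E n by rewrite addrC subrK.
  rewrite exprDn coef_sum.
  under [RHS]eq_bigr => m _ do rewrite exprZn coefZ mulrA divfK ?expf_neq0 ?pnatr_eq0//.
  under [LHS]eq_bigr => m _ do rewrite coefMn expr1n mul1r.
  rewrite -(big_mkord xpredT (fun m => (E n ^+ m)`_i *+ 'C(n.+1, m))).
  rewrite -[RHS](big_mkord xpredT (fun m => 'C(n.+1, m)%:R * (E n ^+ m)`_i)).
  under [RHS]eq_bigr do rewrite mulr_natl.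
  (* The two ranges of summation differ by terms that vanish: powers of E n above i if i <= n + 1,
     binomial coefficients above n + 1 otherwise. *)
  case: (leqP i n.+1) => h.
    rewrite (@big_cat_nat _ _ _ i.+1)//= [X in _ + X]big_nat_cond [X in _ + X]big1 ?addr0//.
    by move=> m /andP[/andP[im _] _]; rewrite coef_exp_lt// mul0rn.
  rewrite [RHS](@big_cat_nat _ _ _ n.+2)//=; last exact: leqW.
  rewrite [X in _ + X]big_nat_cond [X in _ + X]big1 ?addr0//.
  by move=> m /andP[/andP[im _] _]; rewrite bin_small.
apply: cvg_big; [exact: add_continuous|] => m _; apply: cvgM; first exact: binomial_scaled_cvg.
exact: poly_cvgX.
Qed.

(* The limit of [(1 + C / n) ^ n] turns the exponential law into [poly_cvgM]. *)
Lemma exp_coefD C D i : C`_0 = 0 -> D`_0 = 0 -> (i <= r)%N ->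
  exp_coef (C + D) i = \sum_(j < i.+1) exp_coef C j * exp_coef D (i - j).
Proof.
move=> C0 D0 ir.
pose A (E : {poly R}) n : {poly R} := 1 + n.+1%:R^-1 *: E.
have A0 (E : {poly R}) n : E`_0 = 0 -> (A E n)`_0 = 1.
  by move=> E0; rewrite coefD coef1 coefZ E0 mulr0 addr0.
have AS (E : {poly R}) j n : (0 < j)%N -> n.+1%:R * (A E n)`_j = E`_j.
  by move=> j0; rewrite coefD coef1 gtn_eqF// add0r coefZ mulrA divff ?mul1r.
have lim1 (E : {poly R}) j : E`_0 = 0 -> (j <= r)%N ->
    (A E n ^+ n.+1)`_j @[n --> \oo] --> exp_coef E j.
  move=> E0; apply: exp_coef_limit => // [n|l /andP[l0 _]]; first exact: A0.
  by under eq_fun do rewrite AS//; exact: cvg_cst.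
have lim2 : ((A C n * A D n) ^+ n.+1)`_i @[n --> \oo] --> exp_coef (C + D) i.
  move: i ir; apply: (exp_coef_limit (fun n => A C n * A D n)) => [n||l /andP[l0 lr]].
  - by rewrite coefM big_ord1 !A0// mulr1.
  - by rewrite coefD C0 D0 addr0.
  (* The product of the two first-order factors is 1 + (C + D) / (n + 1) up to a second-order cross
     term. *)
  have -> : (fun n => n.+1%:R * (A C n * A D n)`_l) =
      (fun n => (C + D)`_l + harmonic n * (C * D)`_l).
    apply/funext => n; rewrite /A /= mulrDl mul1r mulrDr mulr1 -scalerAl -scalerAr.
    rewrite !coefD !coefZ coef1 gtn_eqF//=.
    have : (n.+1%:R : R) != 0 by []; move: (n.+1%:R) => x x0; by field.
  rewrite -[X in _ --> X]addr0 -[X in _ --> _ + X](mul0r (C * D)`_l).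
  apply: cvgD; first exact: cvg_cst.
  by apply: cvgM; [exact: cvg_harmonic|exact: cvg_cst].
apply: (cvg_unique _ lim2) => //.
have -> : (fun n => ((A C n * A D n) ^+ n.+1)`_i) = (fun n =>
    \sum_(j < i.+1) (A C n ^+ n.+1)`_j * (A D n ^+ n.+1)`_(i - j)).
  by apply/funext => n; rewrite exprMn coefM.
apply: cvg_big; [exact: add_continuous|] => j _.
have ji : (j <= i)%N by rewrite -ltnS.
apply: cvgM; apply: lim1 => //; first exact: leq_trans ir.
by rewrite (leq_trans _ ir)// leq_subr.
Qed.

(** Expanding the power gives one monomial per tuple. Degree r selects the tuples of sum r, and the
    vanishing constant coefficient removes those with a zero part, leaving the compositions of the
    theorem. *)
Lemma coef_exp_compositions (c : nat -> R) (n : nat) :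
  ((\poly_(i < r.+1) (if i == 0%N then 0 else c i)) ^+ n)`_r =
  \sum_(m : {ffun 'I_n -> 'I_r.+1} |
       (\sum_(l < n) m l == r)%N && [forall l, (0 < m l)%N]) \prod_(l < n) c (m l).
Proof.
rewrite -[n in LHS]card_ord -prodr_const poly_def.
rewrite bigA_distr_bigA/= coef_sum [RHS]big_mkcond/=; apply: eq_bigr => m _.
have -> : \prod_l ((if m l == 0 :> nat then 0 else c (m l)) *: 'X^(m l)) =
  (\prod_l (if m l == 0 :> nat then 0 else c (m l))) *: 'X^(\sum_l m l) :> {poly R}.
  by rewrite scaler_prod; congr (_ *: _); rewrite -prodrXr.
rewrite coefZ coefXn eq_sym; case: eqVneq => /= _; last by rewrite mulr0.
rewrite mulr1; case: ifPn => [/forallP h|].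
  by apply: eq_bigr => l _; rewrite gtn_eqF.
rewrite negb_forall => /existsP[l]; rewrite -eqn0Ngt => h.
by rewrite (bigD1 l)//= h mul0r.
Qed.

End poly_convergence.

(** * Signs and growth of binomial coefficients at integers *)

Section gbinom_signs.
Context {R : realType}.

Lemma gbinom_nat (m r : nat) : gbinom (m%:R : R) r = 'C(m, r)%:R.
Proof.
by rewrite /gbinom falling_nat -bin_ffact natrM mulfK// factr_neq0.
Qed.

Lemma gbinom_opp_nat (m r : nat) :
  gbinom (- m%:R : R) r = (-1) ^+ r * 'C((m + r).-1, r)%:R.
Proof.
rewrite /gbinom falling_opp_nat rising_ffact -bin_ffact natrM mulrA.
by rewrite mulfK// factr_neq0.
Qed.

Lemma bin_le_exp2 m r : ('C(m, r) <= 2 ^ m)%N.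
Proof.
have -> : (2 ^ m = \sum_(i < m.+1) 'C(m, i))%N.
  rewrite -[2%N]/(1 + 1)%N expnDn; apply: eq_bigr => i _.
  by rewrite !exp1n !muln1.
case: (leqP r m) => rm; last by rewrite bin_small.
by rewrite (bigD1 (Ordinal (rm : (r < m.+1)%N)))//= leq_addr.
Qed.

(** The flag b is false for M1 and true for M2, which enters the Skellam process with a minus
    sign. *)
Definition signed_gbinom (b : bool) (r : nat) (m : nat) : R :=
  gbinom ((-1) ^+ b * m%:R) r.

Lemma signed_gbinomE (b : bool) (m r : nat) : exists c : nat,
  (c <= 2 ^ (m + r))%N /\ signed_gbinom b r m = (-1) ^+ b ^+ r * c%:R.
Proof.
rewrite /signed_gbinom; case: b => /=.
  exists 'C((m + r).-1, r); split; last by rewrite mulN1r gbinom_opp_nat.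
  by rewrite (leq_trans (bin_le_exp2 _ _))// leq_pexp2l// leq_pred.
exists 'C(m, r); split; last by rewrite mul1r gbinom_nat expr1n mul1r.
by rewrite (leq_trans (bin_le_exp2 _ _))// leq_pexp2l// leq_addr.
Qed.

(** The sign depends on b and r but not on m, so the absolute value can be taken out of an
    expectation as a constant sign. *)
Lemma signed_gbinom_norm b r m :
  `|signed_gbinom b r m| = (-1) ^+ b ^+ r * signed_gbinom b r m.
Proof.
have [c [_ ->]] := signed_gbinomE b m r.
rewrite normrM normr_nat mulrA -exprMn -expr2 sqrr_sign expr1n mul1r.
by rewrite -exprM normr_sign mul1r.
Qed.

Lemma signed_gbinom_sqr b r m : (signed_gbinom b r m) ^+ 2 <= 4 ^+ (m + r).
Proof.
have [c [cm ->]] := signed_gbinomE b m r.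
rewrite exprMn -!exprM -signr_odd !oddM andbF mul1r -!natrX.
rewrite ler_nat -[4%N]/(2 ^ 2)%N -expnM mulnC expnM.
by rewrite leq_exp2r.
Qed.

End gbinom_signs.

(** * Independent random times *)

Section null_modifications.
Context d (T : measurableType d) (R : realType).
Variable mu : {measure set T -> \bar R}.
Local Open Scope ereal_scope.
Import HBNNSimple.

(* No measurability is assumed: the integral is a supremum over simple
   functions, each of which may be multiplied by the indicator of [~` N]. *)
Lemma ge0_integral_eq_off_null (N : set T) (f g : T -> \bar R) :
  measurable N -> mu N = 0 -> (forall x, 0 <= f x) -> (forall x, 0 <= g x) ->
  (forall x, ~ N x -> f x = g x) -> \int[mu]_x f x = \int[mu]_x g x.
Proof.
move=> mN muN f0 g0 fg.
suff H (f1 g1 : T -> \bar R) : (forall x, 0 <= f1 x) -> (forall x, 0 <= g1 x) ->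
    (forall x, ~ N x -> f1 x = g1 x) -> \int[mu]_x f1 x <= \int[mu]_x g1 x.
  by apply/eqP; rewrite eq_le !H// => x Nx; rewrite fg.
move=> {}f0 {}g0 {}fg; rewrite !ge0_integralTE//.
apply: ge_ereal_sup => _ [h /= hf <-].
pose h' : {nnsfun T >-> R} := mul_nnsfun h (indic_nnsfun R (measurableC mN)).
apply: ereal_sup_ubound => /=; exists h' => [x|].
  rewrite /= /mindic !indicE; have [xN|xN] := boolP (x \in ~` N).
    by rewrite mulr1 -fg; [exact: hf|move: xN; rewrite inE].
  by rewrite mulr0.
rewrite -!integralT_nnsfun; apply: ge0_ae_eq_integral => //.
- exact/measurable_EFinP.
- exact/measurable_EFinP.
- by move=> x _; rewrite lee_fin fun_ge0.
- by move=> x _; rewrite lee_fin fun_ge0.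
exists N; split => // x /=; apply: contra_notP => xN _.
by rewrite /= /mindic indicE mem_set// mulr1.
Qed.

Lemma integral_eq_off_null (N : set T) (f g : T -> \bar R) :
  measurable N -> mu N = 0 ->
  (forall x, ~ N x -> f x = g x) -> \int[mu]_x f x = \int[mu]_x g x.
Proof.
move=> mN muN fg; rewrite integralE [RHS]integralE; congr (_ - _);
  apply: (@ge0_integral_eq_off_null N) => // x Nx.
- by rewrite !funeposE fg.
- by rewrite !funenegE fg.
Qed.

End null_modifications.

(** * Tonelli and Fubini for independent random elements *)

Section independence_fubini.
Context d d1 d2 (T : measurableType d) (T1 : measurableType d1)
  (T2 : measurableType d2) (R : realType) (P : probability T R).
Variables (U : {mfun T >-> T1}) (V : {mfun T >-> T2}).
Local Open Scope ereal_scope.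

Hypothesis indep : forall A B, measurable A -> measurable B ->
  P (U @^-1` A `&` V @^-1` B) = P (U @^-1` A) * P (V @^-1` B).

Let UV w := (U w, V w).

Let mUV : measurable_fun setT UV.
Proof. exact/measurable_fun_pairP. Qed.

Let UVm : {mfun T >-> (T1 * T2)%type} :=
  HB.pack UV (isMeasurableFun.Build _ _ _ _ _ mUV).

(** Independence is the product formula on rectangles, and rectangles determine the product
    measure. *)
Let lawE A : measurable A ->
  (distribution P U \x distribution P V) A = distribution P UVm A.
Proof.
move=> mA; refine (@product_measure_unique _ _ _ _ _ (distribution P U) (distribution P V)
  (distribution P UVm) _ _ mA) => B C mB mC.
by rewrite -[RHS]indep//.
Qed.

Lemma indep_tonelli (f : T1 * T2 -> \bar R) : measurable_fun setT f ->
  (forall x, 0 <= f x) ->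
  \int[P]_w f (U w, V w) = \int[P]_w \int[P]_w' f (U w, V w').
Proof.
move=> mf f0.
transitivity (\int[distribution P UVm]_x f x).
  by rewrite ge0_integral_distribution.
transitivity (\int[distribution P U \x distribution P V]_x f x).
  by apply: eq_measure_integral => A mA _; exact/esym/lawE.
rewrite fubini_tonelli1// ge0_integral_distribution//=; last 2 first.
- exact: measurable_fun_fubini_tonelli_F.
- by move=> x; apply: integral_ge0.
apply: eq_integral => w _ /=; rewrite /fubini_F ge0_integral_distribution//.
exact: measurableT_comp.
Qed.

Lemma indep_measurable_inner (f : T1 * T2 -> \bar R) : measurable_fun setT f ->
  (forall x, 0 <= f x) ->
  measurable_fun setT (fun w => \int[P]_w' f (U w, V w')).
Proof.
move=> mf f0.
apply: (eq_measurable_fun (fubini_F (distribution P V) f \o U)).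
  move=> w _ /=; rewrite /fubini_F ge0_integral_distribution//.
  exact: measurableT_comp.
by apply: measurableT_comp => //; exact: measurable_fun_fubini_tonelli_F.
Qed.

(** Tonelli is applied to the positive and negative parts. The iterated integral of |f| dominates
    both, so their outer integrals are finite and may be subtracted. *)
Lemma indep_fubini (f : T1 * T2 -> R) : measurable_fun setT f ->
  \int[P]_w \int[P]_w' `|f (U w, V w')|%:E < +oo ->
  P.-integrable setT (fun w => (f (U w, V w))%:E) /\
  \int[P]_w (f (U w, V w))%:E = \int[P]_w \int[P]_w' (f (U w, V w'))%:E.
Proof.
move=> mf foo.
have mEf : measurable_fun setT (EFin \o f) by exact/measurable_EFinP.
have mabs : measurable_fun setT (fun x => `|f x|%:E).
  by apply/measurable_EFinP; exact: measurableT_comp.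
split.
  apply/integrableP; split; first exact: (measurableT_comp mEf mUV).
  by rewrite -(indep_tonelli _ mabs) in foo.
have mp : measurable_fun setT (EFin \o f)^\+ by exact: measurable_funepos.
have mn : measurable_fun setT (EFin \o f)^\- by exact: measurable_funeneg.
have fin (g : T1 * T2 -> \bar R) : measurable_fun setT g ->
    (forall x, 0 <= g x) -> (forall x, g x <= `|f x|%:E) ->
    P.-integrable setT (fun w => \int[P]_w' g (U w, V w')).
  move=> mg g0 gf; apply/integrableP; split; first exact: indep_measurable_inner.
  apply: le_lt_trans foo; apply: ge0_le_integral => //.
  - by apply: measurableT_comp => //; exact: indep_measurable_inner.
  - exact: (indep_measurable_inner _ mabs).
  - move=> w _; rewrite gee0_abs; last exact: integral_ge0.
    apply: ge0_le_integral => //.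
    + by apply: (measurableT_comp mg); exact: (measurable_fun_pair (measurable_cst _) (measurable_funP V)).
    + by apply: (measurableT_comp mabs); exact: (measurable_fun_pair (measurable_cst _) (measurable_funP V)).
have abs_split x : `|f x|%:E = (EFin \o f)^\+ x + (EFin \o f)^\- x.
  by have /(congr1 (@^~ x)) := fune_abse (EFin \o f).
rewrite integralE.
rewrite [X in X - _](_ : _ = \int[P]_w (EFin \o f)^\+ (U w, V w)); last first.
  by apply: eq_integral => w _; rewrite !funeposE.
rewrite [X in _ - X](_ : _ = \int[P]_w (EFin \o f)^\- (U w, V w)); last first.
  by apply: eq_integral => w _; rewrite !funenegE.
rewrite !(indep_tonelli _ mp, indep_tonelli _ mn)// -integralB//; last 2 first.
- by apply: fin => // x; rewrite abs_split leeDl.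
- by apply: fin => // x; rewrite abs_split leeDr.
apply: eq_integral => w _; rewrite [RHS]integralE.
by congr (_ - _); apply: eq_integral => w' _; rewrite ?funeposE ?funenegE.
Qed.

End independence_fubini.

(** * Joint measurability of right-continuous processes *)

Section right_continuous_processes.
Context {R : realType}.

Definition right_continuous_paths {T : Type} (X : R -> T -> R) :=
  forall w t, 0 <= t -> X ^~ w @ t^'+ --> X t w.

(** The successor of the integer part keeps the grid point strictly above t, as the punctured filter
    [t^'+] demands. *)
Definition grid_above (n : nat) (t : R) : R :=
  (Num.truncn (n.+1%:R * t)).+1%:R / n.+1%:R.

Lemma grid_above_gt n t : 0 <= t -> t < grid_above n t.
Proof.
move=> t0; rewrite /grid_above ltr_pdivlMr// mulrC.
by have /andP[] := truncn_itv (mulr_ge0 (ler0n R n.+1) t0).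
Qed.

Lemma grid_above_le n t : 0 <= t -> grid_above n t <= t + n.+1%:R^-1.
Proof.
move=> t0; rewrite /grid_above ler_pdivrMr// mulrDl mulVf// -natr1 lerD2r [leRHS]mulrC.
by have /andP[] := truncn_itv (mulr_ge0 (ler0n R n.+1) t0).
Qed.

Lemma grid_above_cvg t : 0 <= t -> grid_above n t @[n --> \oo] --> t.
Proof.
move=> t0; apply: (@squeeze_cvgr _ _ _ _ (fun=> t) (fun n => t + harmonic n)).
- by near=> n; rewrite (ltW (grid_above_gt _ _ t0)) grid_above_le.
- exact: cvg_cst.
- rewrite -[X in _ --> X]addr0; apply: cvgD; first exact: cvg_cst.
  exact: cvg_harmonic.
Unshelve. all: by end_near. Qed.

(** The process is the pointwise limit of its values at the next grid point. Each approximation is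
    constant in time on every grid cell, so its preimages are countable unions of rectangles. *)
Lemma measurable_right_continuous d (T : measurableType d) (X : R -> T -> R) :
  is_process X -> right_continuous_paths X ->
  measurable_fun [set: R * T] (fun p => X (Num.max p.1 0) p.2).
Proof.
move=> mX rcX; pose Y n (p : R * T) := X (grid_above n (Num.max p.1 0)) p.2.
apply: (measurable_fun_cvg (h := Y)); last first.
  move=> [t w] _ /=.
  have t0 : 0 <= Num.max t 0 by rewrite le_max lexx orbT.
  have /cvg_at_rightP := rcX w _ t0; apply; split.
    by move=> n; exact: grid_above_gt.
  exact: grid_above_cvg.
move=> n _ B mB; rewrite setTI.
rewrite (_ : _ @^-1` _ = \bigcup_j
  ([set t : R | Num.truncn (n.+1%:R * Num.max t 0) = j] `*`
   (X (j.+1%:R / n.+1%:R) @^-1` B))); last first.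
  apply/seteqP; split => [[t w] /= BY|[t w] [j _ [/= <-]]//].
  by exists (Num.truncn (n.+1%:R * Num.max t 0)).
apply: bigcup_measurable => j _; apply: measurableX; last first.
  by rewrite -[X in measurable X]setTI; apply: mX => //; rewrite divr_ge0.
pose h (t : R) := n.+1%:R * Num.max t 0.
have mh : measurable_fun setT h.
  by apply: measurable_funM => //; exact: measurable_maxr.
rewrite (_ : [set _ | _] = h @^-1` `[j%:R, j.+1%:R[%classic).
  by rewrite -[X in measurable X]setTI; exact: mh.
apply/seteqP; split => t /=; rewrite in_itv/= -/(h t).
  by move=> <-; apply: truncn_itv; rewrite mulr_ge0// le_max lexx orbT.
exact: truncn_def.
Qed.

End right_continuous_processes.

(** * A process evaluated at an independent random time *)

Section independent_random_time.
Context d (T : measurableType d) (R : realType) (P : probability T R).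
Variables (X : R -> T -> R) (tau : T -> R).
Hypotheses (mX : is_process X) (rcX : right_continuous_paths X).
Hypothesis mtau : measurable_fun setT tau.
Hypothesis indep : forall A B, process_sigma_algebra X A -> measurable B ->
  P (A `&` tau @^-1` B) = (P A * P (tau @^-1` B))%E.

Let path_gen := [set A | exists (t : R) (B : set R),
         [/\ 0 <= t, measurable B & A = X t @^-1` B]].
(** The path space is T itself with the sigma-algebra generated by X, and the random path is the
    identity map. Independence of X and tau thereby becomes independence of two random elements. *)
Let paths : measurableType _ := g_sigma_algebraType path_gen.

Let measurable_path : measurable_fun setT (id : T -> paths).
Proof.
move=> _ A mA; rewrite setTI.
apply: (smallest_sub _ _ mA); first exact: sigma_algebra_measurable.
move=> _ [t [B [t0 mB ->]]].
by rewrite -[X in measurable X]setTI; exact: mX.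
Qed.

Let path : {mfun T >-> paths} :=
  HB.pack (id : T -> paths) (isMeasurableFun.Build _ _ _ _ _ measurable_path).

Let taum : {mfun T >-> R} :=
  HB.pack tau (isMeasurableFun.Build _ _ _ _ _ mtau).

Let process_paths : is_process (X : R -> paths -> R).
Proof.
move=> t t0 _ B mB; rewrite setTI; apply: sub_sigma_algebra.
by exists t, B.
Qed.

Lemma measurable_random_time :
  measurable_fun setT (fun w => X (Num.max (tau w) 0) w).
Proof.
have mf := measurable_right_continuous _ _ _ mX rcX.
exact: (measurableT_comp mf (measurable_fun_pair mtau (@measurable_id _ _ _))).
Qed.

Lemma random_time_measurable_inner (g : R -> R) : measurable_fun setT g ->
  measurable_fun setT (fun w => \int[P]_w' `|g (X (Num.max (tau w) 0) w')|%:E)%E.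
Proof.
move=> mg.
have mf := measurable_right_continuous _ _ _ process_paths rcX.
have := @indep_measurable_inner _ _ _ _ _ _ _ P taum path.
move=> /(_ (fun p : R * paths => `|g (X (Num.max p.1 0) p.2)|%:E)); apply => //.
by apply/measurable_EFinP; apply: measurableT_comp => //; exact: measurableT_comp.
Qed.

Lemma random_time_fubini (g : R -> R) : measurable_fun setT g ->
  (\int[P]_w \int[P]_w' `|g (X (Num.max (tau w) 0) w')|%:E < +oo)%E ->
  P.-integrable setT (fun w => (g (X (Num.max (tau w) 0) w))%:E) /\
  (\int[P]_w (g (X (Num.max (tau w) 0) w))%:E =
   \int[P]_w \int[P]_w' (g (X (Num.max (tau w) 0) w'))%:E)%E.
Proof.
move=> mg goo.
have mf := measurable_right_continuous _ _ _ process_paths rcX.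
have := @indep_fubini _ _ _ _ _ _ _ P taum path.
move=> /(_ _ (fun p : R * paths => g (X (Num.max p.1 0) p.2))); apply => //.
  move=> A B mA mB; rewrite setIC muleC /=; exact: indep.
exact: measurableT_comp.
Qed.

End independent_random_time.

(** * Limits of moments along couplings *)

Lemma cvgn_le {R : realType} (u : R^nat) (l c : R) :
  u n @[n --> \oo] --> l -> (forall n, u n <= c) -> l <= c.
Proof.
move=> ul uc; have <- : lim (u n @[n --> \oo]) = l by exact/cvg_lim.
by apply: limr_le; [apply/cvg_ex; exists l|near=> n; exact: uc].
Unshelve. all: by end_near. Qed.

Lemma cvgn_ge {R : realType} (u : R^nat) (l c : R) :
  u n @[n --> \oo] --> l -> (forall n, c <= u n) -> c <= l.
Proof.
move=> ul uc; have <- : lim (u n @[n --> \oo]) = l by exact/cvg_lim.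
by apply: limr_ge; [apply/cvg_ex; exists l|near=> n; exact: uc].
Unshelve. all: by end_near. Qed.

Lemma cvg_integral_monotone d (T : measurableType d) (R : realType)
    (mu : {measure set T -> \bar R}) (D : set T) (h : (T -> \bar R)^nat)
    (g : T -> \bar R) : measurable D ->
  (forall n, measurable_fun D (h n)) -> (forall n w, D w -> 0 <= h n w)%E ->
  (forall w, D w -> nondecreasing_seq (h ^~ w)) ->
  (forall w, D w -> h n w @[n --> \oo] --> g w) ->
  (\int[mu]_(w in D) h n w)%E @[n --> \oo] --> (\int[mu]_(w in D) g w)%E.
Proof.
move=> mD mh h0 hnd hg.
rewrite (@eq_integral _ _ _ mu D (fun w => limn (h ^~ w)) g); last first.
  by move=> w /set_mem Dw; apply/esym/cvg_lim => //; exact: hg.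
exact: cvg_monotone_convergence.
Qed.

Section coupled_limit.
Context d (T : measurableType d) (R : realType) (P : probability T R).
Variables (Yn : nat -> T -> R) (Y : T -> R) (A : nat -> set T) (K : R).
Hypotheses (mYn : forall n, measurable_fun setT (Yn n))
  (mY : measurable_fun setT Y) (mA : forall n, measurable (A n)).
Hypothesis YnY : forall n w, ~ A n w -> Yn n w = Y w.
Hypothesis PA0 : fine (P (A n)) @[n --> \oo] --> (0 : R).
Hypothesis Yn2 : forall n, (\int[P]_w ((Yn n w) ^+ 2)%:E <= K%:E)%E.

Let K0 : 0 <= K.
Proof.
rewrite -lee_fin; apply: le_trans (Yn2 0%N); apply: integral_ge0 => w _.
by rewrite lee_fin sqr_ge0.
Qed.

Let PAE n : P (A n) = (fine (P (A n)))%:E.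
Proof. by rewrite fineK// fin_num_measure. Qed.

(** Y and Yn differ only on A n, where the truncated square is at most L. The error L P(A n)
    vanishes in the limit, and the bound K does not depend on L, which lets monotone convergence
    remove the truncation afterwards. *)
Let trunc_second_moment (L : R) : 0 <= L ->
  (\int[P]_w (Num.min ((Y w) ^+ 2) L)%:E <= K%:E)%E.
Proof.
move=> L0.
have mm : measurable_fun setT (fun w => Num.min ((Y w) ^+ 2) L).
  by apply: measurable_minr => //; exact: measurable_funX.
have H n : (\int[P]_w (Num.min ((Y w) ^+ 2) L)%:E <=
    (K + L * fine (P (A n)))%:E)%E.
  apply: (@le_trans _ _ (\int[P]_w ((Yn n w ^+ 2)%:E + (L * \1_(A n) w)%:E))%E).
    apply: ge0_le_integral => //.
    - by move=> w _; rewrite lee_fin le_min sqr_ge0.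
    - exact/measurable_EFinP.
    - apply: emeasurable_funD; apply/measurable_EFinP; first exact: measurable_funX.
      by apply: measurable_funM => //; exact: measurable_indic.
    - move=> w _; rewrite -EFinD lee_fin indicE.
      have [|/negP] := boolP (w \in A n); rewrite inE => Aw.
        by rewrite mulr1 ge_min [X in _ || X]lerDr sqr_ge0 orbT.
      by rewrite mulr0 addr0 ge_min YnY// lexx.
  rewrite ge0_integralD//; last 4 first.
  - by move=> w _; rewrite lee_fin sqr_ge0.
  - by apply/measurable_EFinP; exact: measurable_funX.
  - by move=> w _; rewrite lee_fin mulr_ge0.
  - by apply/measurable_EFinP/measurable_funM => //; exact: measurable_indic.
  rewrite EFinD leeD//; under eq_integral do rewrite EFinM.
  rewrite ge0_integralZl_EFin//; last first.
    by apply/measurable_EFinP; exact: measurable_indic.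
  by rewrite integral_indic// setIT EFinM -PAE.
have fin : (\int[P]_w (Num.min ((Y w) ^+ 2) L)%:E)%E \is a fin_num.
  rewrite ge0_fin_numE; first exact: le_lt_trans (H 0%N) (ltry _).
  by apply: integral_ge0 => w _; rewrite lee_fin le_min sqr_ge0.
rewrite -(fineK fin) lee_fin -[leRHS]addr0 -[X in _ + X](mulr0 L).
apply: (cvgn_ge (fun n => K + L * fine (P (A n)))).
  by apply: cvgD; [exact: cvg_cst|apply: cvgM => //; exact: cvg_cst].
by move=> n; rewrite -lee_fin fineK.
Qed.

Let second_moment : (\int[P]_w ((Y w) ^+ 2)%:E <= K%:E)%E.
Proof.
pose h n w := (Num.min ((Y w) ^+ 2) n%:R)%:E : \bar R.
have : (\int[P]_w (h n w))%E @[n --> \oo] --> (\int[P]_w ((Y w) ^+ 2)%:E)%E.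
  apply: cvg_integral_monotone => //.
  - by move=> n; apply/measurable_EFinP/measurable_minr => //; exact: measurable_funX.
  - by move=> n w _; rewrite lee_fin le_min sqr_ge0 ler0n.
  - move=> w _ m n mn; rewrite lee_fin le_min ge_min lexx/=.
    by rewrite ge_min ler_nat mn orbT.
  - move=> w _; apply: cvg_near_cst; near=> n.
    rewrite /h; congr EFin; apply/min_idPl.
    by near: n; exact: nbhs_infty_ger.
move=> /cvg_lim <-//; apply: lime_le.
  apply: ereal_nondecreasing_is_cvgn => m n mn; apply: ge0_le_integral => //.
  - by move=> w _; rewrite lee_fin le_min sqr_ge0 ler0n.
  - by apply/measurable_EFinP/measurable_minr => //; exact: measurable_funX.
  - by apply/measurable_EFinP/measurable_minr => //; exact: measurable_funX.
  - move=> w _; rewrite lee_fin le_min ge_min lexx/=.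
    by rewrite ge_min ler_nat mn orbT.
by near=> n; exact: trunc_second_moment.
Unshelve. all: by end_near. Qed.

Let sq_integrable (Z : T -> R) : measurable_fun setT Z ->
  (\int[P]_w ((Z w) ^+ 2)%:E <= K%:E)%E ->
  P.-integrable setT (fun w => ((Z w) ^+ 2)%:E).
Proof.
move=> mZ Z2; apply/integrableP; split.
  by apply/measurable_EFinP; exact: measurable_funX.
rewrite (le_lt_trans _ (ltry K))// (le_trans _ Z2)//.
by under eq_integral do rewrite gee0_abs ?lee_fin ?sqr_ge0//.
Qed.

Let first_integrable (Z : T -> R) : measurable_fun setT Z ->
  (\int[P]_w ((Z w) ^+ 2)%:E <= K%:E)%E ->
  P.-integrable setT (fun w => (Z w)%:E).
Proof.
move=> mZ Z2.
have := integrableD measurableT (finite_measure_integrable_cst P 1 measurableT)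
  (sq_integrable _ mZ Z2).
apply: le_integrable => //; first exact/measurable_EFinP.
move=> w _; rewrite /= lee_fin [leRHS]ger0_norm; last by rewrite addr_ge0 ?sqr_ge0.
rewrite -real_normK ?num_real//; move: `|Z w| => z; nra.
Qed.

Lemma coupled_limit_integrable : P.-integrable setT (fun w => (Y w)%:E).
Proof. exact: first_integrable. Qed.

(** Second moments give uniform integrability. On A n one has |z| <= L + z^2 / L with z = Yn - Y and
    z^2 <= 2 Yn^2 + 2 Y^2, while z = 0 elsewhere; the error is at most L P(A n) + 4 K / L. *)
Lemma coupled_limit_cvg :
  Rintegral P setT (Yn n) @[n --> \oo] --> Rintegral P setT Y.
Proof.
have iY := coupled_limit_integrable.
have iYn n : P.-integrable setT (EFin \o Yn n) by exact: first_integrable.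
have bound (L : R) n : 0 < L ->
   `|Rintegral P setT (Yn n) - Rintegral P setT Y| <=
   L * fine (P (A n)) + 4 * K / L.
  move=> L0; rewrite -RintegralB//.
  have iB : P.-integrable setT (fun w => (Yn n w - Y w)%:E).
    exact: (integrableB measurableT (iYn n) iY).
  apply: le_trans (le_normr_Rintegral measurableT iB) _.
  pose F w := L * \1_(A n) w + (2 / L * (Yn n w) ^+ 2 + 2 / L * (Y w) ^+ 2).
  have i1 : P.-integrable setT (fun w => (L * \1_(A n) w)%:E).
    apply: (@integrableZl _ _ _ _ _ measurableT L (fun w => (\1_(A n) w)%:E)).
    exact: integrable_indic.
  have i2 : P.-integrable setT (fun w => (2 / L * (Yn n w) ^+ 2)%:E).
    exact: (integrableZl measurableT (2 / L) (sq_integrable _ (mYn n) (Yn2 n))).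
  have i3 : P.-integrable setT (fun w => (2 / L * (Y w) ^+ 2)%:E).
    exact: (integrableZl measurableT (2 / L) (sq_integrable _ mY second_moment)).
  have i23 : P.-integrable setT (fun w => (2 / L * (Yn n w) ^+ 2 + 2 / L * (Y w) ^+ 2)%:E).
    exact: (integrableD measurableT i2 i3).
  have iF : P.-integrable setT (EFin \o F).
    exact: (integrableD measurableT i1 i23).
  apply: (@le_trans _ _ (Rintegral P setT F)).
    apply: le_Rintegral => //; first exact: integrable_norm.
    move=> w _; rewrite /F indicE.
    have [|/negP] := boolP (w \in A n); rewrite inE => Aw; last first.
      rewrite YnY// subrr normr0 mulr0 add0r.
      by rewrite addr_ge0// mulr_ge0 ?divr_ge0 ?sqr_ge0// ltW.
    rewrite mulr1.
    have : `|Yn n w - Y w| <= L + (Yn n w - Y w) ^+ 2 / L.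
      rewrite -[X in X / L]real_normK ?num_real//; move: `|_ - _| => z.
      have -> : L + z ^+ 2 / L = (L ^+ 2 + z ^+ 2) / L by field; rewrite gt_eqF.
      by rewrite ler_pdivlMr//; nra.
    move=> /le_trans; apply; rewrite lerD2l.
    have -> : 2 / L * Yn n w ^+ 2 + 2 / L * Y w ^+ 2 =
      (2 * Yn n w ^+ 2 + 2 * Y w ^+ 2) / L by field; rewrite gt_eqF.
    apply: ler_wpM2r; first by rewrite invr_ge0 ltW.
    rewrite -subr_ge0.
    have -> : 2 * Yn n w ^+ 2 + 2 * Y w ^+ 2 - (Yn n w - Y w) ^+ 2 =
      (Yn n w + Y w) ^+ 2 by ring.
    exact: sqr_ge0.
  rewrite /F RintegralD// RintegralD// RintegralZl//; last exact: integrable_indic.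
  rewrite RintegralZl//; last exact: sq_integrable.
  rewrite RintegralZl//; last exact: sq_integrable.
  have fineK2 (Z : T -> R) : measurable_fun setT Z ->
      (\int[P]_w ((Z w) ^+ 2)%:E <= K%:E)%E ->
      Rintegral P setT (fun w => Z w ^+ 2) <= K.
    move=> mZ Z2; rewrite -lee_fin /Rintegral fineK//.
    exact: integrable_fin_num (sq_integrable _ mZ Z2).
  have -> : Rintegral P setT \1_(A n) = fine (P (A n)).
    by rewrite /Rintegral integral_indic// setIT.
  rewrite lerD2l -mulrDr -mulrA [leRHS](_ : _ = 2 / L * (K + K)); last by ring.
  apply: ler_wpM2l; first by rewrite divr_ge0 ?ltW.
  by rewrite lerD// fineK2.
apply/cvgrPdist_le => e e0.
(* This makes 4 K / L at most e / 2, and the added 1 keeps L positive when K = 0. *)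
pose L := (4 * K + 1) * 2 / e.
have K1 : 0 < 4 * K + 1 by rewrite ltr_wpDl// mulr_ge0.
have L0 : 0 < L by rewrite divr_gt0// mulr_gt0.
have PAL : L * fine (P (A n)) @[n --> \oo] --> (0 : R).
  by rewrite -(mulr0 L); apply: cvgM => //; exact: cvg_cst.
near=> n.
rewrite distrC (le_trans (bound L n L0))//.
have : L * fine (P (A n)) <= e / 2.
  near: n; move/cvgrPdist_le : PAL => /(_ (e / 2)); rewrite divr_gt0//.
  move=> /(_ isT); apply: filterS => n; rewrite sub0r normrN.
  exact/le_trans/ler_norm.
have : 4 * K / L <= e / 2.
  rewrite ler_pdivrMr//.
  have -> : e / 2 * L = 4 * K + 1 by rewrite /L; field; rewrite gt_eqF.
  by rewrite lerDl.
lra.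
Unshelve. all: by end_near. Qed.

End coupled_limit.

(** * Generalized counting processes *)

Lemma Rintegral_sum d (T : measurableType d) (R : realType)
    (mu : {measure set T -> \bar R}) (I : Type) (s : seq I) (f : I -> T -> R) :
  (forall i, mu.-integrable setT (EFin \o f i)) ->
  Rintegral mu setT (fun w => \sum_(i <- s) f i w) =
  \sum_(i <- s) Rintegral mu setT (f i).
Proof.
move=> fi; rewrite /Rintegral; under eq_integral do rewrite -sumEFin.
rewrite (@integral_sum _ _ _ mu _ measurableT _ (fun i w => (f i w)%:E))//.
rewrite -sum_fine// => i _; exact: (integrable_fin_num measurableT (fi i)).
Qed.

Lemma measure_eq_off_null d (T : measurableType d) (R : realType)
    (mu : {measure set T -> \bar R}) (N A B : set T) :
  measurable N -> mu N = 0%E -> measurable A -> measurable B ->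
  (forall w, ~ N w -> A w <-> B w) -> mu A = mu B.
Proof.
move=> mN N0 mA mB AB.
suff H (C D : set T) : measurable C -> measurable D ->
    (forall w, ~ N w -> C w -> D w) -> (mu C <= mu D)%E.
  by apply/eqP; rewrite eq_le !H// => w /AB[].
move=> mC mD CD; rewrite -[leRHS]adde0 -N0.
apply: (le_trans _ (measureU2 _ mD mN)); apply: le_measure; rewrite ?inE//.
  exact: measurableU.
by move=> w Cw; have [Nw|Nw] := pselect (N w); [right|left; exact: CD].
Qed.

Lemma measurable_gbinom (R : realType) (r : nat) :
  measurable_fun [set: R] (fun x : R => gbinom x r).
Proof.
apply: measurable_funM => //; rewrite /real_falling_factorial.
by apply: measurable_prod => i _; exact: measurable_funB.
Qed.

Section jumps.
Context {R : realType} (k : nat).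

(** Reads x as a jump size; anything outside 0, ..., k is read as 0. Hence [ord0] covers both a
    genuine absence of jump and a misread value. *)
Definition jump (x : R) : 'I_k.+1 := odflt ord0 [pick v : 'I_k.+1 | x == v%:R].

Lemma jump_nat (v : 'I_k.+1) : jump v%:R = v.
Proof.
rewrite /jump; case: pickP => [u /=|/(_ v)]; last by rewrite eqxx.
by rewrite eqr_nat => /eqP/val_inj.
Qed.

Lemma jumpK (x : R) : jump x != ord0 -> (jump x)%:R = x.
Proof.
by rewrite /jump; case: pickP => [u /eqP <-//|]; rewrite eqxx.
Qed.

Lemma jumpE (v : 'I_k.+1) : v != ord0 -> jump @^-1` [set v] = [set v%:R].
Proof.
move=> v0; apply/seteqP; split => x /=; last by move=> ->; exact: jump_nat.
by move=> jx; rewrite -jx jumpK// jx.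
Qed.

Lemma measurable_jump (v : 'I_k.+1) : measurable (jump @^-1` [set v]).
Proof.
have [->|v0] := eqVneq v ord0; last by rewrite jumpE.
rewrite (_ : _ @^-1` _ = ~` \bigcup_(u in [set u : 'I_k.+1 | u != ord0]) [set u%:R]).
  apply: measurableC; apply: fin_bigcup_measurable => //.
apply/seteqP; split => x /=.
  by move=> jx [u /= u0 xu]; move: jx; rewrite xu jump_nat => /eqP; apply/negP.
move=> h; apply/eqP/negPn/negP => jx0; apply: h; exists (jump x) => //=.
by rewrite jumpK.
Qed.

End jumps.

(* The infinitesimal rates give the law of a bounded version of the increments
   over [t / n]; [jump_count] adds these up and agrees with [M t] outside an
   event of vanishing probability. *)
Section gcp_moments.
Context d (T : measurableType d) (R : realType) (P : probability T R).
Context (k : nat) (lambda : 'I_k -> R) (M : R -> T -> R).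
Hypothesis M_gcp : is_GCP P lambda M.

Let mM : is_process M. Proof. by case: M_gcp => -[]. Qed.

Lemma gcp_start : exists N, [/\ measurable N, P N = 0%E &
  forall w, ~ N w -> M 0 w = 0].
Proof.
case: M_gcp => -[_ _ [N [mN N0 NM]] _ _] _ _; exists N; split => // w Nw.
by apply: contrapT => Mw; apply/Nw/NM.
Qed.

Section fixed_time.
Variables (t : R) (t0 : 0 <= t).

Definition step_length (n : nat) : R := t / n.+1%:R.
Local Notation h := step_length.

Let h0 n : 0 <= h n. Proof. by rewrite divr_ge0. Qed.

Definition increment n i w := M (i.+1%:R * h n) w - M (i%:R * h n) w.

Let m_inc n i : measurable_fun setT (increment n i).
Proof. by apply: measurable_funB; apply: mM; rewrite mulr_ge0. Qed.

Let increment_law n i (B : set R) : measurable B ->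
  P [set w | B (increment n i w)] = P [set w | B (M (h n) w)].
Proof.
move=> mB; case: M_gcp => -[_ _ _ _ stat] _ _.
have := stat (i%:R * h n) (h n) B; rewrite mulr_ge0// h0 => /(_ isT isT mB).
rewrite /increment -[i.+1%:R]natr1 mulrDl mul1r => ->.
have [N [mN N0 NM]] := gcp_start.
have mm0 : measurable_fun setT (fun w => M (h n) w - M 0 w).
  by apply: measurable_funB; exact: mM.
apply: (measure_eq_off_null _ _ _ P N) => //.
- by rewrite -[X in measurable X]setTI; exact: mm0.
- by rewrite -[X in measurable X]setTI; exact: (mM _ (h0 n)).
- by move=> w Nw /=; rewrite NM// subr0.
Qed.

Definition jump_prob n (v : 'I_k.+1) : R := fine (P [set w | jump k (M (h n) w) = v]).

Let m_jumpM n v : measurable [set w | jump k (M (h n) w) = v].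
Proof.
rewrite (_ : [set _ | _] = M (h n) @^-1` (jump k @^-1` [set v]))//.
by rewrite -[X in measurable X]setTI; apply: mM => //; exact: measurable_jump.
Qed.

Let PE (A : set T) : measurable A -> P A = (fine (P A))%:E.
Proof. by move=> mA; rewrite fineK// fin_num_measure. Qed.

Definition step_jump n i w : 'I_k.+1 := jump k (increment n i w).

Definition jump_count n w : nat := (\sum_(i < n.+1) step_jump n i w)%N.

Let history n (v : {ffun 'I_n.+1 -> 'I_k.+1}) : set T :=
  [set w | forall i : 'I_n.+1, step_jump n i w = v i].

Let m_history n v : measurable (history n v).
Proof.
rewrite /history (_ : [set _ | _] =
  \bigcap_(i in [set: 'I_n.+1]) (increment n i @^-1` (jump k @^-1` [set v i]))).
  apply: fin_bigcap_measurable => // i _.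
  by rewrite -[X in measurable X]setTI; apply: m_inc => //; exact: measurable_jump.
by apply/seteqP; split => w H i; [move=> _|]; exact: H.
Qed.

Let history_prob n v : P (history n v) = (\prod_(i < n.+1) jump_prob n (v i))%:E.
Proof.
case: M_gcp => -[_ _ _ indep _] _ _.
(* [inord] extends v to a sequence indexed by nat, the form in which independence of increments is
   stated. *)
pose B (i : nat) := @jump R k @^-1` [set v (inord i)].
have mB i : measurable (B i) by exact: measurable_jump.
have := indep n.+1 (fun i => i%:R * h n) B; rewrite mul0r => /(_ (lexx _)).
have incr (i : nat) : i%:R * h n <= i.+1%:R * h n.
  by apply: ler_wpM2r => //; rewrite ler_nat.
move=> /(_ incr mB).
rewrite (_ : [set _ | _] = history n v); last first.
  apply/seteqP; split => w /= H.
    by move=> i; have := H i (ltn_ord i); rewrite /B /= inord_val.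
  move=> i ni; have := H (Ordinal ni).
  by rewrite /B /= -[X in inord X]/(val (Ordinal ni)) inord_val.
move=> ->.
rewrite -prodEFin; apply: eq_bigr => i _.
rewrite -[LHS]/(P [set w | B i (increment n i w)]) increment_law// /B inord_val.
by rewrite /jump_prob -PE.
Qed.

(** The count takes finitely many values, each history having a product probability, so every
    function g of it is a finite combination of indicators and is integrable. *)
Lemma expectation_jump_count n (g : nat -> R) :
  P.-integrable setT (fun w => (g (jump_count n w))%:E) /\
  Rintegral P setT (fun w => g (jump_count n w)) =
  \sum_(v : {ffun 'I_n.+1 -> 'I_k.+1})
    (\prod_i jump_prob n (v i)) * g (\sum_i v i)%N.
Proof.
have E : (fun w => g (jump_count n w)) = (fun w =>
    \sum_(v : {ffun 'I_n.+1 -> 'I_k.+1}) g (\sum_i v i)%N * \1_(history n v) w).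
  apply/funext => w.
  pose v0 := [ffun i : 'I_n.+1 => step_jump n i w].
  rewrite (bigD1 v0)//= [X in _ + X]big1 ?addr0.
    rewrite indicE mem_set/= ?mulr1; last by move=> i; rewrite ffunE.
    by congr (g _); apply: eq_bigr => i _; rewrite ffunE.
  move=> v vv0; rewrite indicE memNset ?mulr0// => H; move/eqP: vv0; apply.
  by apply/ffunP => i; rewrite ffunE H.
have fi (v : {ffun 'I_n.+1 -> 'I_k.+1}) : P.-integrable setT
    (EFin \o (fun w => g (\sum_i v i)%N * \1_(history n v) w)).
  apply: (@integrableZl _ _ _ _ _ measurableT (g (\sum_i v i)%N)
    (fun w => (\1_(history n v) w)%:E)).
  exact: integrable_indic.
split.
  rewrite (_ : (fun _ => _) = EFin \o (fun w => g (jump_count n w)))// E.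
  have := @integrable_sum _ _ _ P _ measurableT _ (index_enum _) xpredT _
    (fun v _ => fi v).
  by apply: eq_integrable => // w _; rewrite /= sumEFin.
rewrite E Rintegral_sum//; apply: eq_bigr => v _.
rewrite RintegralZl//; last exact: integrable_indic.
rewrite /Rintegral integral_indic// setIT mulrC; congr (_ * _).
exact: (congr1 fine (history_prob n v)).
Qed.

Lemma jump_prob_sum n : \sum_v jump_prob n v = 1.
Proof.
have mv v : measurable [set w | jump k (M (h n) w) = v] by exact: m_jumpM.
have -> : \sum_v jump_prob n v = \sum_v Rintegral P setT \1_[set w | jump k (M (h n) w) = v].
  by apply: eq_bigr => v _; rewrite /Rintegral integral_indic// setIT.
rewrite -Rintegral_sum; last by move=> v; exact: integrable_indic.
transitivity (Rintegral P setT (fun=> 1)).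
  congr Rintegral; apply/funext => w; rewrite (bigD1 (jump k (M (h n) w)))//= big1 ?addr0.
    by rewrite indicE mem_set.
  by move=> v vw; rewrite indicE memNset//= => H; move/eqP: vw; apply.
rewrite Rintegral_cst// mul1r; exact: (congr1 fine (probability_setT P)).
Qed.

Lemma jump_prob_lift n (i : 'I_k) :
  jump_prob n (lift ord0 i) = fine (P [set w | M (h n) w = i.+1%:R]).
Proof.
rewrite /jump_prob; congr (fine (P _)).
have := @jumpE R k (lift ord0 i) isT.
move=> /(congr1 (fun A => M (h n) @^-1` A)).
by rewrite /preimage /= /bump /= add1n.
Qed.

(** For t > 0, (n + 1) u(h) = t u(h) / h with h decreasing to 0. At t = 0 every step has length 0,
    outside the reach of the right limit, and u 0 = 0 is used. *)
Let scaled_rate (u : R -> R) (l : R) : u 0 = 0 ->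
  u x / x @[x --> 0^'+] --> l -> n.+1%:R * u (h n) @[n --> \oo] --> t * l.
Proof.
move=> u0 ul; have [t00|tn0] := eqVneq t 0.
  have h00 n : h n = 0 by rewrite /step_length t00 mul0r.
  by under eq_fun do rewrite h00 u0 mulr0; rewrite t00 mul0r; exact: cvg_cst.
have tp : 0 < t by rewrite lt_neqAle eq_sym tn0.
have -> : (fun n => n.+1%:R * u (h n)) = (fun n => t * (u (h n) / h n)).
  apply/funext => n; have : (n.+1%:R : R) != 0 by [].
  move: (u _) => y; rewrite /step_length; move: (n.+1%:R : R) => x x0.
  by field; rewrite x0 tn0.
apply: cvgM; first exact: cvg_cst.
move/cvg_at_rightP : ul; apply; split; first by move=> n; rewrite divr_gt0.
rewrite -(mulr0 t); apply: cvgM; first exact: cvg_cst.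
exact: cvg_harmonic.
Qed.

Let start_prob (c : R) : fine (P [set w | M 0 w = c]) = (c == 0)%:R.
Proof.
have [N [mN N0 NM]] := gcp_start.
have mc : measurable [set w | M 0 w = c].
  rewrite (_ : [set _ | _] = M 0 @^-1` [set c])//.
  by rewrite -[X in measurable X]setTI; exact: mM.
move: mc; have [->|c0] := eqVneq c 0 => mc.
  rewrite (measure_eq_off_null _ _ _ P N _ setT)//.
    exact: (congr1 fine (probability_setT P)).
  by move=> w Nw; split => // _; exact: NM.
rewrite (measure_eq_off_null _ _ _ P N _ set0) ?measure0//.
by move=> w Nw; split => //= H; move/eqP: c0; apply; rewrite -H NM.
Qed.

Lemma jump_prob_rate (i : 'I_k) :
  n.+1%:R * jump_prob n (lift ord0 i) @[n --> \oo] --> t * lambda i.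
Proof.
under eq_fun do rewrite jump_prob_lift.
case: M_gcp => _ /(_ i) rate _; move: rate.
apply: (scaled_rate (fun x => fine (P [set w | M x w = i.+1%:R]))).
by rewrite start_prob pnatr_eq0.
Qed.

Lemma no_jump_rate :
  n.+1%:R * (1 - fine (P [set w | M (h n) w = 0])) @[n --> \oo] -->
  t * \sum_(i < k) lambda i.
Proof.
case: M_gcp => _ _; apply: (scaled_rate (fun x => 1 - fine (P [set w | M x w = 0]))).
by rewrite start_prob eqxx subrr.
Qed.

(** The nonzero values that [jump] misreads as 0. *)
Let off : set R := jump k @^-1` [set ord0] `\` [set 0].

Let m_off : measurable off.
Proof. by apply: measurableD => //; exact: measurable_jump. Qed.

Let m_off_inc n i : measurable [set w | off (increment n i w)].
Proof.
rewrite (_ : [set _ | _] = increment n i @^-1` off)//.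
by rewrite -[X in measurable X]setTI; exact: m_inc.
Qed.

Let jump_prob_sum_lift n :
  jump_prob n ord0 = 1 - \sum_(j < k) jump_prob n (lift ord0 j).
Proof. by rewrite -(jump_prob_sum n) big_ord_recl addrK. Qed.

Let off_prob n i : fine (P [set w | off (increment n i w)]) =
  (1 - fine (P [set w | M (h n) w = 0])) -
  \sum_(j < k) jump_prob n (lift ord0 j).
Proof.
rewrite increment_law// addrAC -jump_prob_sum_lift.
have mz : measurable [set w | M (h n) w = 0].
  rewrite (_ : [set _ | _] = M (h n) @^-1` [set 0])//.
  by rewrite -[X in measurable X]setTI; exact: (mM _ (h0 n)).
have mj := m_jumpM n ord0.
rewrite (_ : [set _ | _] =
  [set w | jump k (M (h n) w) = ord0] `\` [set w | M (h n) w = 0]); last by [].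
rewrite measureD//; last by rewrite -ge0_fin_numE// fin_num_measure.
rewrite (_ : _ `&` _ = [set w | M (h n) w = 0]); last first.
  apply/seteqP; split => w /=; first by case.
  by move=> ->; split => //; exact: (jump_nat k ord0).
by rewrite fineB//; exact: fin_num_measure.
Qed.

(** If no increment is misread and M 0 = 0, the increments telescope to M t. By [off_prob] the
    probability of a misreading in one step is the difference of two quantities with the same
    first-order rate, so the union bound over n + 1 steps still tends to 0. *)
Let bad_event : exists A : nat -> set T,
  [/\ forall n, measurable (A n),
      forall n w, ~ A n w -> (jump_count n w)%:R = M t w &
      fine (P (A n)) @[n --> \oo] --> (0 : R)].
Proof.
have [N [mN N0 NM]] := gcp_start.
pose O n : set T := \big[setU/set0]_(i < n.+1) [set w | off (increment n i w)].
have mO n : measurable (O n) by exact: bigsetU_measurable.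
exists (fun n => O n `|` N); split.
- by move=> n; exact: measurableU.
- move=> n w; rewrite /O -(bigcup_mkord n.+1 (fun i => [set w | off (increment n i w)])).
  move=> /not_orP[nO nN].
  rewrite /jump_count natr_sum.
  transitivity (\sum_(i < n.+1) increment n i w).
    apply: eq_bigr => i _; rewrite /step_jump.
    have [j0|] := eqVneq (jump k (increment n i w)) ord0; last exact: jumpK.
    rewrite j0; apply/esym/eqP/negPn/negP => /eqP i0; apply: nO.
    by exists i => //=; split.
  rewrite -(big_mkord xpredT (fun i => increment n i w)).
  rewrite (telescope_sumr (fun i => M (i%:R * h n) w))// mul0r NM// subr0.
  by rewrite mulrC divfK.
have lim : n.+1%:R * ((1 - fine (P [set w | M (h n) w = 0])) -
    \sum_(j < k) jump_prob n (lift ord0 j)) @[n --> \oo] --> (0 : R).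
  have E : t * (\sum_(j < k) lambda j) - \sum_(j < k) t * lambda j = 0.
    by rewrite mulr_sumr subrr.
  rewrite -[X in _ --> X]E; under eq_fun do rewrite mulrBr mulr_sumr.
  apply: cvgB; first exact: no_jump_rate.
  by apply: cvg_big; [exact: add_continuous|move=> j _; exact: jump_prob_rate].
apply: (squeeze_cvgr _ (cvg_cst 0) lim); near=> n.
apply/andP; split; first by rewrite fine_ge0.
rewrite -lee_fin -PE; last exact: measurableU.
apply: (le_trans (measureU2 _ (mO n) mN)).
have -> : (P (O n) + P N = P (O n))%E by rewrite N0 adde0.
have /le_trans := @Boole_inequality _ _ _ P
  (fun i => [set w | off (increment n i w)]) n.+1 (fun i _ => m_off_inc n i).
apply.
rewrite mulrC mulr_natr -[X in _ *+ X]card_ord -sumr_const -sumEFin.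
by apply: lee_sum => i _; rewrite -(off_prob n i) -PE.
Unshelve. all: by end_near. Qed.

Variable b : bool.

Definition jump_poly r n : {poly R} :=
  \sum_(v < k.+1) jump_prob n v *: gbinom_poly r ((-1) ^+ b * v%:R).

Lemma expectation_signed_gbinom r n i : (i <= r)%N ->
  Rintegral P setT (fun w => signed_gbinom b i (jump_count n w)) =
  (jump_poly r n ^+ n.+1)`_i.
Proof.
move=> ir; rewrite (expectation_jump_count n (signed_gbinom b i)).2.
rewrite coef_exp_gbinom_poly//; apply: eq_bigr => v _; congr (_ * _).
by rewrite /signed_gbinom natr_sum mulr_sumr.
Qed.

Definition gcp_poly r : {poly R} := \poly_(i < r.+1)
  (if i == 0%N then 0 else \sum_(j < k) lambda j * gbinom ((-1) ^+ b * j.+1%:R) i).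

Lemma jump_poly_limit r i : (i <= r)%N ->
  (jump_poly r n ^+ n.+1)`_i @[n --> \oo] --> exp_coef (t *: gcp_poly r) i.
Proof.
move: i; apply: exp_coef_limit.
- move=> n; rewrite coef_sum -[RHS](jump_prob_sum n); apply: eq_bigr => v _.
  by rewrite coefZ (gbinom_polyP _ _ 0%N)// gbinom0 mulr1.
- by rewrite coefZ coef_poly mulr0.
move=> i /andP[i0 ir]; rewrite coefZ coef_poly ltnS ir gtn_eqF// mulr_sumr.
(* A jump of size 0 contributes nothing in positive degree, so only probabilities governed by the
   rates remain. *)
have -> : (fun n => n.+1%:R * (jump_poly r n)`_i) = (fun n =>
    \sum_(j < k) (n.+1%:R * jump_prob n (lift ord0 j)) *
                 gbinom ((-1) ^+ b * j.+1%:R) i).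
  apply/funext => n; rewrite coef_sum big_ord_recl coefZ (gbinom_polyP _ _ i)//.
  rewrite mulr0; case: i i0 ir => // i _ ir; rewrite gbinom_0S mulr0 add0r.
  rewrite mulr_sumr; apply: eq_bigr => j _.
  by rewrite coefZ (gbinom_polyP _ _ i.+1)// mulrA.
apply: cvg_big; [exact: add_continuous|] => j _; rewrite mulrA.
by apply: cvgM; [exact: jump_prob_rate|exact: cvg_cst].
Qed.

(** The square is at most 4^(count + r). By independence the mean of this bound is 4^r (1 - sum p_j
    + s n)^(n + 1), hence at most 4^r exp((n + 1) s n), and (n + 1) s n converges. *)
Let second_moment_bound r : exists K : R, forall n,
  (\int[P]_w ((signed_gbinom b r (jump_count n w)) ^+ 2)%:E <= K%:E)%E.
Proof.
pose s n : R := \sum_(j < k) jump_prob n (lift ord0 j) * 4 ^+ j.+1.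
have s0 n : 0 <= s n.
  by apply: sumr_ge0 => j _; rewrite mulr_ge0 ?fine_ge0 ?exprn_ge0.
have : n.+1%:R * s n @[n --> \oo] --> \sum_(j < k) t * lambda j * 4 ^+ j.+1.
  under eq_fun do rewrite /s mulr_sumr.
  apply: cvg_big; [exact: add_continuous|] => j _.
  under eq_fun do rewrite mulrA.
  by apply: cvgM; [exact: jump_prob_rate|exact: cvg_cst].
move=> /cvgP /cvg_seq_bounded /pinfty_ex_gt0[B _ sB].
exists (4 ^+ r * expR B) => n.
have [fi fE] := expectation_jump_count n (fun m => 4 ^+ (m + r)).
apply: (@le_trans _ _ (\int[P]_w (4 ^+ (jump_count n w + r))%:E)%E).
  apply: ge0_le_integral => //.
  - by move=> w _; rewrite lee_fin sqr_ge0.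
  - exact: measurable_int (expectation_jump_count n (fun m => signed_gbinom b r m ^+ 2)).1.
  - exact: measurable_int fi.
  - by move=> w _; rewrite lee_fin; exact: signed_gbinom_sqr.
rewrite -(fineK (integrable_fin_num measurableT fi)) lee_fin.
rewrite -[leLHS]/(Rintegral P setT (fun w => 4 ^+ (jump_count n w + r))) fE.
have -> : \sum_(v : {ffun 'I_n.+1 -> 'I_k.+1})
    (\prod_i jump_prob n (v i)) * 4 ^+ (\sum_i v i + r) =
  4 ^+ r * (\sum_(v < k.+1) jump_prob n v * 4 ^+ v) ^+ n.+1.
  rewrite -[n.+1 in RHS]card_ord -prodr_const bigA_distr_bigA/= mulr_sumr.
  apply: eq_bigr => v _; rewrite exprD mulrA [RHS]mulrC; congr (_ * _).
  by rewrite big_split/= prodrXr.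
apply: ler_wpM2l; first exact: exprn_ge0.
rewrite big_ord_recl expr0 mulr1 jump_prob_sum_lift.
rewrite (_ : \sum_(i < k) jump_prob n (lift ord0 i) * 4 ^+ lift ord0 i = s n)//.
have : 1 - \sum_(j < k) jump_prob n (lift ord0 j) + s n <= expR (s n).
  apply: le_trans (expR_ge1Dx _); rewrite lerD2r gerBl.
  by apply: sumr_ge0 => j _; rewrite fine_ge0.
have u0 : 0 <= 1 - \sum_(j < k) jump_prob n (lift ord0 j) + s n.
  by rewrite -jump_prob_sum_lift addr_ge0// fine_ge0.
move=> /(@lerXn2r _ n.+1 _ _ u0 (ltW (expR_gt0 _))) /le_trans; apply.
rewrite -expRM_natl ler_expR; have := sB n I; apply: le_trans.
exact: ler_norm.
Qed.

Lemma gcp_binomial_moment r i : (i <= r)%N ->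
  [/\ P.-integrable setT (fun w => (gbinom ((-1) ^+ b * M t w) i)%:E),
      Rintegral P setT (fun w => gbinom ((-1) ^+ b * M t w) i) =
        exp_coef (t *: gcp_poly r) i &
      Rintegral P setT (fun w => `|gbinom ((-1) ^+ b * M t w) i|) =
        (-1) ^+ b ^+ i * exp_coef (t *: gcp_poly r) i].
Proof.
move=> ir.
have [A [mA AM PA]] := bad_event.
have [K Kb] := second_moment_bound i.
have mY : measurable_fun setT (fun w => gbinom ((-1) ^+ b * M t w) i).
  apply: (measurableT_comp (measurable_gbinom R i)).
  by apply: measurable_funM => //; exact: mM.
have mYn n (g : nat -> R) : measurable_fun setT (fun w => g (jump_count n w)).
  by apply/measurable_EFinP; exact: measurable_int (expectation_jump_count n g).1.
have YnY n w : ~ A n w ->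
    signed_gbinom b i (jump_count n w) = gbinom ((-1) ^+ b * M t w) i.
  by move=> Aw; rewrite /signed_gbinom AM.
split.
- exact: (coupled_limit_integrable _ _ _ _ _ _ _ _ (fun n => mYn n _) mY mA YnY PA Kb).
- have := coupled_limit_cvg _ _ _ _ _ _ _ _ (fun n => mYn n _) mY mA YnY PA Kb.
  under eq_fun do rewrite (expectation_signed_gbinom r)//.
  by move=> /(cvg_unique (@Rhausdorff R)); apply; exact: jump_poly_limit.
(* The sign rule concerns natural numbers. It is applied to the counts, and a second passage to the
   limit carries it over to M t. *)
have mY' : measurable_fun setT (fun w => `|gbinom ((-1) ^+ b * M t w) i|).
  exact: measurableT_comp.
have YnY' n w : ~ A n w ->
    `|signed_gbinom b i (jump_count n w)| = `|gbinom ((-1) ^+ b * M t w) i|.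
  by move=> Aw; rewrite YnY.
have Kb' n : (\int[P]_w (`|signed_gbinom b i (jump_count n w)| ^+ 2)%:E <= K%:E)%E.
  by under eq_integral do rewrite real_normK ?num_real//.
have := coupled_limit_cvg _ _ _ _ _ _ _ _
  (fun n => mYn n (fun m => `|signed_gbinom b i m|)) mY' mA YnY' PA Kb'.
have -> : (fun n => Rintegral P setT (fun w => `|signed_gbinom b i (jump_count n w)|)) =
    (fun n => (-1) ^+ b ^+ i * (jump_poly r n ^+ n.+1)`_i).
  apply/funext => n; rewrite -(expectation_signed_gbinom r)// -RintegralZl//.
    by apply: eq_Rintegral => w _; rewrite signed_gbinom_norm.
  exact: (expectation_jump_count n _).1.
move=> /(cvg_unique (@Rhausdorff R)); apply.
by apply: cvgM; [exact: cvg_cst|exact: jump_poly_limit].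
Qed.

End fixed_time.
End gcp_moments.

(** * Generalized Skellam processes *)

Section independent_products.
Context d (T : measurableType d) (R : realType) (P : probability T R).

Lemma indep_product_expectation (U V : {mfun T >-> R}) (g h : R -> R) :
  (forall A B, measurable A -> measurable B ->
    P (U @^-1` A `&` V @^-1` B) = P (U @^-1` A) * P (V @^-1` B))%E ->
  measurable_fun setT g -> measurable_fun setT h ->
  P.-integrable setT (fun w => (g (U w))%:E) ->
  P.-integrable setT (fun w => (h (V w))%:E) ->
  P.-integrable setT (fun w => (g (U w) * h (V w))%:E) /\
  Rintegral P setT (fun w => g (U w) * h (V w)) =
  Rintegral P setT (fun w => g (U w)) * Rintegral P setT (fun w => h (V w)).
Proof.
move=> UV mg mh gi hi.
pose f (x : R * R) := g x.1 * h x.2.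
have mf : measurable_fun setT f.
  by apply: measurable_funM; [exact: (measurableT_comp mg)|exact: (measurableT_comp mh)].
have hn : P.-integrable setT (EFin \o (fun w => `|h (V w)|)) by exact: integrable_norm.
have gn : P.-integrable setT (EFin \o (fun w => `|g (U w)|)) by exact: integrable_norm.
have inner (a : R) (k : R -> R) : P.-integrable setT (EFin \o (fun w => k (V w))) ->
    (\int[P]_w (a * k (V w))%:E = (a * Rintegral P setT (fun w => k (V w)))%:E)%E.
  move=> ki; under eq_integral do rewrite EFinM.
  rewrite integralZl// EFinM /Rintegral fineK//.
  exact: integrable_fin_num.
have [] := indep_fubini _ _ _ _ _ _ _ P U V UV f mf; last first.
  move=> fi fE; split => //.
  rewrite {1}/Rintegral (_ : (\int[P]_w (g (U w) * h (V w))%:E =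
    \int[P]_w (f (U w, V w))%:E)%E)// fE.
  under eq_integral do rewrite /f /= inner//.
  by rewrite -[LHS]/(Rintegral P setT _) RintegralZr.
under eq_integral do under eq_integral do rewrite /f /= normrM.
under eq_integral do rewrite (inner _ (fun x => `|h x|))//.
rewrite -[ltLHS]fineK ?ltry//; apply: integrable_fin_num => //.
under eq_fun do rewrite EFinM muleC.
exact: (@integrableZl _ _ _ P _ measurableT _ (fun w => `|g (U w)|%:E)).
Qed.

End independent_products.

Section exp_coef_facts.
Context {R : realType}.
Implicit Types (C D : {poly R}).

Lemma exp_coefZ (t : R) C i :
  exp_coef (t *: C) i = \sum_(m < i.+1) t ^+ m / m`!%:R * (C ^+ m)`_i.
Proof.
apply: eq_bigr => m _; rewrite exprZn coefZ mulrA; congr (_ * _).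
by rewrite mulrC.
Qed.

(** Up to degree i, D(z) = C(-z), and this relation passes to powers. *)
Lemma coef_exp_sign C D i m :
  (forall j, (j <= i)%N -> D`_j = (-1) ^+ j * C`_j) ->
  (D ^+ m)`_i = (-1) ^+ i * (C ^+ m)`_i.
Proof.
elim: m i => [|m IH] i DC.
  by rewrite !expr0 coef1; case: i {DC} => [|i]; rewrite ?expr0 ?mul1r ?mulr0.
rewrite !exprS !coefM mulr_sumr; apply: eq_bigr => j _.
have ji : (j <= i)%N by rewrite -ltnS.
rewrite DC// IH; last by move=> l /leq_trans li; rewrite DC// li// leq_subr.
by rewrite mulrACA -exprD subnKC.
Qed.

End exp_coef_facts.

Section gsp_moments.
Context d (T : measurableType d) (R : realType) (P : probability T R).
Context (k : nat) (lambda mu : 'I_k -> R) (X : R -> T -> R).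

Definition gsp_rate (m : nat) : R :=
  \sum_(j < k) lambda j * gbinom (j.+1%:R) m + \sum_(j < k) mu j * gbinom (- j.+1%:R) m.

Definition gsp_poly r : {poly R} :=
  \poly_(i < r.+1) (if i == 0%N then 0 else gsp_rate i).

(* [(-1) ^+ i * gbinom (- j) i] is the absolute value of [gbinom (- j) i]. *)
Definition gsp_abs_poly r : {poly R} :=
  \poly_(i < r.+1) (if i == 0%N then 0 else
    \sum_(j < k) lambda j * gbinom (j.+1%:R) i +
    \sum_(j < k) mu j * ((-1) ^+ i * gbinom (- j.+1%:R) i)).

Hypothesis X_gsp : is_GSP P lambda mu X.

(** Vandermonde splits binom(M1 - M2, r), independence factors each term, and [exp_coefD]
    reassembles the two exponentials. The absolute moment is only bounded because the triangle
    inequality is applied to the Vandermonde sum; each of its terms is computed exactly. *)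
Lemma gsp_binomial_moment r (t : R) : 0 <= t ->
  [/\ P.-integrable setT (fun w => (gbinom (X t w) r)%:E),
      Rintegral P setT (fun w => gbinom (X t w) r) =
        \sum_(m < r.+1) t ^+ m / m`!%:R * (gsp_poly r ^+ m)`_r &
      Rintegral P setT (fun w => `|gbinom (X t w) r|) <=
        \sum_(m < r.+1) t ^+ m / m`!%:R * (gsp_abs_poly r ^+ m)`_r].
Proof.
move=> t0; case: X_gsp => M1 [M2 [gcp1 gcp2 ind XE]].
have m1 : measurable_fun setT (M1 t) by case: gcp1 => -[+ _ _ _ _ _ _]; apply.
have m2 : measurable_fun setT (M2 t) by case: gcp2 => -[+ _ _ _ _ _ _]; apply.
pose U : {mfun T >-> R} := HB.pack (M1 t) (isMeasurableFun.Build _ _ _ _ _ m1).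
pose V : {mfun T >-> R} := HB.pack (M2 t) (isMeasurableFun.Build _ _ _ _ _ m2).
have UV A B : measurable A -> measurable B ->
    (P (U @^-1` A `&` V @^-1` B) = P (U @^-1` A) * P (V @^-1` B))%E.
  move=> mA mB; apply: ind; apply: sub_sigma_algebra.
    by exists t, A.
  by exists t, B.
have mom1 i (ir : (i <= r)%N) := gcp_binomial_moment _ _ _ _ _ _ _ gcp1 _ t0 false r i ir.
have mom2 i (ir : (i <= r)%N) := gcp_binomial_moment _ _ _ _ _ _ _ gcp2 _ t0 true r i ir.
pose C1 := gcp_poly R k lambda false r; pose C2 := gcp_poly R k mu true r.
have XD w : gbinom (X t w) r =
    \sum_(i < r.+1) gbinom (M1 t w) i * gbinom (- M2 t w) (r - i).
  by rewrite XE// gbinomD.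
have mgN i : measurable_fun setT (fun x : R => gbinom (- x) i).
  exact: (measurableT_comp (measurable_gbinom R i)).
have int1 i : (i <= r)%N -> P.-integrable setT (fun w => (gbinom (M1 t w) i)%:E).
  by move=> /mom1[+ _ _]; under eq_fun do rewrite expr0 mul1r.
have int2 i : (i <= r)%N -> P.-integrable setT (fun w => (gbinom (- M2 t w) i)%:E).
  by move=> /mom2[+ _ _]; under eq_fun do rewrite expr1 mulN1r.
have rS (i : 'I_r.+1) : (i <= r)%N by rewrite -ltnS.
have prod (i : 'I_r.+1) := indep_product_expectation _ _ _ P U V _ _ UV
  (measurable_gbinom R i) (mgN (r - i)%N) (int1 i (rS i)) (int2 _ (leq_subr i r)).
have prodn (i : 'I_r.+1) := indep_product_expectation _ _ _ P U V
  (fun x => `|gbinom x i|) (fun x => `|gbinom (- x) (r - i)|) UV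
  (measurableT_comp (@normr_measurable R setT) (measurable_gbinom R i))
  (measurableT_comp (@normr_measurable R setT) (mgN (r - i)%N))
  (integrable_norm (int1 i (rS i)))
  (integrable_norm (int2 _ (leq_subr i r))).
have fi : P.-integrable setT (fun w => (gbinom (X t w) r)%:E).
  have := @integrable_sum _ _ _ P _ measurableT _ (index_enum _) xpredT _
    (fun (i : 'I_r.+1) _ => (prod i).1).
  by apply: eq_integrable => // w _; rewrite XD sumEFin.
split => //.
  under eq_Rintegral do rewrite XD.
  rewrite Rintegral_sum; last by move=> i; exact: (prod i).1.
  rewrite -exp_coefZ (_ : t *: gsp_poly r = t *: C1 + t *: C2); last first.
    rewrite -scalerDr; congr (_ *: _); apply/polyP => i.
    rewrite coefD !coef_poly; case: ltnP => // _; last by rewrite addr0.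
    case: eqP => _; first by rewrite addr0.
    congr (_ + _); apply: eq_bigr => j _; rewrite ?expr0 ?mul1r//.
    by rewrite expr1 mulN1r.
  rewrite (exp_coefD r)//; last 2 first.
  - by rewrite coefZ coef_poly mulr0.
  - by rewrite coefZ coef_poly mulr0.
  apply: eq_bigr => i _; rewrite (prod i).2; congr (_ * _).
    have [_ <- _] := mom1 i (rS i).
    by apply: eq_Rintegral => w _; rewrite expr0 mul1r.
  have [_ <- _] := mom2 _ (leq_subr i r).
  by apply: eq_Rintegral => w _; rewrite expr1 mulN1r.
apply: (@le_trans _ _ (Rintegral P setT (fun w =>
    \sum_(i < r.+1) `|gbinom (M1 t w) i| * `|gbinom (- M2 t w) (r - i)|))).
  apply: le_Rintegral => //; first exact: integrable_norm.
    have := @integrable_sum _ _ _ P _ measurableT _ (index_enum _) xpredT _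
      (fun (i : 'I_r.+1) _ => (prodn i).1).
    by apply: eq_integrable => // w _; rewrite /= sumEFin.
  move=> w _; rewrite XD; apply: le_trans (ler_norm_sum _ _ _) _.
  by apply: ler_sum => i _; rewrite normrM.
rewrite Rintegral_sum; last by move=> i; exact: (prodn i).1.
(* Replacing z by -z turns the generating exponent for -M2 into the one for absolute moments. *)
pose C2' : {poly R} := \poly_(i < r.+1) ((-1) ^+ i * C2`_i).
have C2'E i : (i <= r)%N -> C2'`_i = (-1) ^+ i * C2`_i.
  by move=> ir; rewrite coef_poly ltnS ir.
rewrite -exp_coefZ (_ : t *: gsp_abs_poly r = t *: C1 + t *: C2'); last first.
  rewrite -scalerDr; congr (_ *: _); apply/polyP => i.
  rewrite coefD !coef_poly; case: ltnP => // _; last by rewrite addr0.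
  case: eqP => _; first by rewrite mulr0 addr0.
  congr (_ + _); first by apply: eq_bigr => j _; rewrite ?expr0 ?mul1r.
  rewrite mulr_sumr; apply: eq_bigr => j _.
  by rewrite expr1 mulN1r mulrCA.
rewrite (exp_coefD r)//; last 2 first.
- by rewrite coefZ coef_poly mulr0.
- by rewrite coefZ C2'E// coef_poly !mulr0.
apply: ler_sum => i _; rewrite (prodn i).2 le_eqVlt; apply/orP; left; apply/eqP.
congr (_ * _).
  have [_ _] := mom1 i (rS i); rewrite expr1n mul1r => <-.
  by apply: eq_Rintegral => w _; rewrite expr0 mul1r.
have [_ _] := mom2 _ (leq_subr i r).
under eq_Rintegral do rewrite expr1 mulN1r.
move=> ->; rewrite expr1 mulr_sumr; apply: eq_bigr => m _.
rewrite mulrCA; congr (_ * _); apply/esym/coef_exp_sign => j jr.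
have jr' : (j <= r)%N by rewrite (leq_trans jr)// leq_subr.
by rewrite coefZ (C2'E j jr') [X in _ = _ * X]coefZ mulrCA.
Qed.

End gsp_moments.

(** * Laplace transforms *)

Section exponential_integrals.
Context {R : realType}.
Local Notation leb := (@lebesgue_measure R).
Implicit Types (f F : R -> R) (a c s x : R) (n : nat).

Lemma ge0_integral_primitive f F a l :
  (forall x, a <= x -> 0 <= f x) -> continuous f ->
  (forall x, is_derive x 1 F (f x)) -> F x @[x --> +oo] --> l ->
  (\int[leb]_(x in `[a, +oo[) (f x)%:E = (l - F a)%:E)%E.
Proof.
move=> f0 cf dF Fl; rewrite (ge0_continuous_FTC2y f0 _ Fl)//.
- by apply: continuous_subspaceT.
- apply: cvg_at_right_filter; apply/differentiable_continuous/derivable1_diffP.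
  by have [] := dF a.
- by move=> x _; rewrite derive1E; have [_ ->] := dF x.
Qed.

Lemma is_derive_continuous f x l : is_derive x 1 f l -> f y @[y --> x] --> f x.
Proof.
by move=> [df _]; apply/differentiable_continuous/derivable1_diffP.
Qed.

Lemma is_derive_pow n x : is_derive x 1 (fun x => x ^+ n) (n%:R * x ^+ n.-1).
Proof.
apply: DeriveDef; first exact: exprn_derivable.
by rewrite exp_derive /GRing.scale/= mulr1.
Qed.

Lemma is_derive_expRN c x :
  is_derive x 1 (fun x => expR (- (c * x))) (- c * expR (- (c * x))).
Proof. by apply: is_derive_eq; rewrite /GRing.scale/=; ring. Qed.

Lemma continuous_pow_expR c n : continuous (fun x => x ^+ n * expR (- (c * x))).
Proof.
move=> x; apply: cvgM; first exact: exprn_continuous.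
exact: is_derive_continuous (is_derive_expRN c x).
Qed.

Lemma measurable_pow_expR c n :
  measurable_fun setT (fun x => x ^+ n * expR (- (c * x))).
Proof. by apply: continuous_measurable_fun; exact: continuous_pow_expR. Qed.

Lemma cvg_pow_expR c n : 0 < c -> x ^+ n * expR (- (c * x)) @[x --> +oo] --> (0 : R).
Proof.
move=> c0.
(* The bound comes from exp(c x) >= (c x)^(n + 1) / (n + 1)!. *)
have K0 : n.+1`!%:R / c ^+ n.+1 * x^-1 @[x --> +oo] --> (0 : R).
  rewrite -(mulr0 (n.+1`!%:R / c ^+ n.+1)); apply: cvgM; first exact: cvg_cst.
  have p0 : \forall x \near +oo, 0 < (id : R -> R) x by exact: nbhs_pinfty_gt.
  by apply/(gtr0_cvgV0 p0).
apply: (squeeze_cvgr _ (cvg_cst 0) K0); near=> x.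
have x0 : 0 < x by [].
rewrite mulr_ge0 ?exprn_ge0 ?expR_ge0 ?(ltW x0)//=.
rewrite expRN ler_pdivrMr ?expR_gt0// mulrAC ler_pdivlMr// -exprSr.
rewrite -ler_pdivrMl ?divr_gt0 ?exprn_gt0 ?ltr0n ?fact_gt0//.
rewrite invf_div mulrAC -exprMn.
have := @expR_ge1Dxn R (c * x) n (mulr_ge0 (ltW c0) (ltW x0)).
by apply: le_trans; rewrite lerDr.
Unshelve. all: by end_near. Qed.

Lemma integral_exp_tail s a : 0 < s ->
  (\int[leb]_(x in `[a, +oo[) (s * expR (- (s * x)))%:E = (expR (- (s * a)))%:E)%E.
Proof.
move=> s0.
have dF x : is_derive x 1 (fun x => - expR (- (s * x))) (s * expR (- (s * x))).
  by apply: is_derive_eq; rewrite /GRing.scale/=; ring.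
rewrite (@ge0_integral_primitive _ (fun x => - expR (- (s * x))) a 0)//.
- by rewrite sub0r opprK.
- by move=> x _; rewrite mulr_ge0 ?expR_ge0 ?ltW.
- move=> x; apply: cvgM; first exact: cvg_cst.
  exact: is_derive_continuous (is_derive_expRN s x).
- rewrite -oppr0; apply: cvgN; have := cvg_pow_expR s 0 s0.
  by under eq_fun do rewrite expr0 mul1r.
Qed.

(** The recursion is integration by parts for x^n exp(-c x). *)
Fixpoint pow_exp_primitive c n x : R :=
  if n is m.+1 then
    - (x ^+ n * expR (- (c * x)) / c) + n%:R / c * pow_exp_primitive c m x
  else - (expR (- (c * x)) / c).

Lemma is_derive_pow_exp_primitive c n x : 0 < c ->
  is_derive x 1 (pow_exp_primitive c n) (x ^+ n * expR (- (c * x))).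
Proof.
move=> c0; elim: n => [|n IH].
  apply: is_derive_eq; rewrite /GRing.scale/= expr0; field.
  by rewrite gt_eqF.
have d1 : is_derive x 1 (fun x => - (x ^+ n.+1 * expR (- (c * x)) / c))
    (- ((n.+1%:R * x ^+ n * expR (- (c * x)) +
         x ^+ n.+1 * (- c * expR (- (c * x)))) / c)).
  have dX := is_derive_pow n.+1 x.
  have dE := is_derive_expRN c x.
  apply: (is_derive_eq (is_deriveN (is_deriveM (is_deriveM dX dE)
    (is_derive_cst c^-1 x 1)))).
  by rewrite /GRing.scale/=; ring.
have d2 : is_derive x 1 (fun x => n.+1%:R / c * pow_exp_primitive c n x)
    (n.+1%:R / c * (x ^+ n * expR (- (c * x)))).
  exact: is_deriveZ.
apply: (is_derive_eq (is_deriveD d1 d2)).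
move: (expR _) (x ^+ n) (x ^+ n.+1) => e u v; field; rewrite gt_eqF//.
Qed.

Lemma integral_pow_exp c n : 0 < c ->
  (\int[leb]_(x in `[0%R, +oo[) (x ^+ n * expR (- (c * x)))%:E =
   (n`!%:R / c ^+ n.+1)%:E)%E.
Proof.
move=> c0.
have Pl : pow_exp_primitive c n x @[x --> +oo] --> (0 : R).
  elim: n => [|n IH] /=.
    rewrite -oppr0 -(mul0r c^-1); apply: cvgN; apply: cvgM; last exact: cvg_cst.
    have := cvg_pow_expR c 0 c0.
    by under eq_fun do rewrite expr0 mul1r.
  rewrite -[X in _ --> X]addr0; apply: cvgD.
    rewrite -oppr0 -(mul0r c^-1); apply: cvgN; apply: cvgM; last exact: cvg_cst.
    exact: cvg_pow_expR.
  by rewrite -(mulr0 (n.+1%:R / c)); apply: cvgM; [exact: cvg_cst|].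
have dP x := is_derive_pow_exp_primitive c n x c0.
rewrite (ge0_integral_primitive _ _ 0 0 _ _ dP Pl)//.
- rewrite sub0r; congr EFin; elim: n {Pl dP} => [|n IH] /=.
    by rewrite mulr0 oppr0 expR0 opprK expr1.
  rewrite exprS !mul0r oppr0 add0r -mulrN IH factS natrM [in RHS]exprS.
  have cn0 : c ^+ n.+1 != 0 by rewrite expf_neq0// gt_eqF.
  by move: (n.+1%:R) (c ^+ n.+1) cn0 => u v v0; field; rewrite v0 gt_eqF.
- by move=> x x0; rewrite mulr_ge0 ?expR_ge0// exprn_ge0.
- exact: continuous_pow_expR.
Qed.

Lemma integral_pow n y : 0 <= y ->
  (\int[leb]_(x in `[0%R, y]) (n.+1%:R * x ^+ n)%:E = (y ^+ n.+1)%:E)%E.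
Proof.
rewrite le_eqVlt => /predU1P[<-|y0].
  by rewrite set_itv1 integral_set1 expr0n.
have cX : continuous (fun x => x ^+ n.+1) by exact: exprn_continuous.
rewrite (@continuous_FTC2 _ _ (fun x => x ^+ n.+1) _ _ y0)//.
- by rewrite expr0n sube0.
- apply: continuous_subspaceT => x; apply: cvgM; first exact: cvg_cst.
  exact: exprn_continuous.
- split.
  + by move=> x _; exact: exprn_derivable.
  + by apply: cvg_at_right_filter; exact: cX.
  + by apply: cvg_at_left_filter; exact: cX.
- by move=> x _; rewrite derive1E; have [_ ->] := is_derive_pow n.+1 x.
Qed.

(** * Gamma function and Laplace transform of powers *)

Section gamma_function.
Variables (a : R) (a0 : 0 < a).
Let g x := x `^ a * expR (- x).

Let g0 x : 0 <= g x.
Proof. by rewrite mulr_ge0 ?powR_ge0 ?expR_ge0. Qed.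

Let mg : measurable_fun setT g.
Proof.
apply: measurable_funM; first exact: measurable_powR.
by apply: (measurableT_comp (@measurable_expR R)); exact: measurable_funN.
Qed.

(** For a natural number n >= a one has x^a <= 1 + x^n on the half-line, which reduces finiteness to
    integer powers. *)
Let g_lty : (\int[leb]_(x in `[0%R, +oo[) (g x)%:E < +oo)%E.
Proof.
pose n := (Num.truncn a).+1.
have an : a <= n%:R by rewrite ltW// truncnS_gt.
apply: (@le_lt_trans _ _ (\int[leb]_(x in `[0%R, +oo[)
    ((x ^+ 0 * expR (- (1 * x)))%:E + (x ^+ n * expR (- (1 * x)))%:E))%E).
  apply: ge0_le_integral => //.
  - by move=> x _; rewrite lee_fin.
  - by apply/measurable_EFinP; exact: measurable_funTS.
  - by apply: emeasurable_funD; apply/measurable_EFinP; apply: measurable_funTS;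
      exact: measurable_pow_expR.
  - move=> x /=; rewrite in_itv/= andbT => x0.
    rewrite -EFinD lee_fin -mulrDl mul1r expr0 ler_wpM2r ?expR_ge0//.
    have [x1|x1] := leP 1 x.
      by rewrite -powR_mulrn// (le_trans (ler_powR x1 an))// lerDr.
    apply: (@le_trans _ _ 1); last by rewrite lerDl exprn_ge0.
    have <- : 1 `^ a = 1 :> R by rewrite powR1.
    by apply: ge0_ler_powR; rewrite ?nnegrE// ltW.
rewrite ge0_integralD//; last 4 first.
- by move=> x _; rewrite lee_fin expr0 mul1r expR_ge0.
- by apply/measurable_EFinP; apply: measurable_funTS; exact: measurable_pow_expR.
- move=> x /=; rewrite in_itv/= andbT => x0.
  by rewrite lee_fin mulr_ge0 ?exprn_ge0 ?expR_ge0.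
- by apply/measurable_EFinP; apply: measurable_funTS; exact: measurable_pow_expR.
by rewrite !integral_pow_exp// -EFinD ltry.
Qed.

Lemma integral_Gamma :
  (\int[leb]_(x in `[0%R, +oo[) (x `^ a * expR (- x))%:E = (Gamma (a + 1))%:E)%E.
Proof.
rewrite -integral_itv_obnd_cbnd; last by apply/measurable_EFinP; exact: measurable_funTS.
rewrite /Gamma addrK /Rintegral fineK// ge0_fin_numE; last first.
  by apply: integral_ge0 => x _; rewrite lee_fin; exact: g0.
rewrite integral_itv_obnd_cbnd//.
by apply/measurable_EFinP; exact: measurable_funTS.
Qed.

Lemma Gamma_gt0 : 0 < Gamma (a + 1).
Proof.
rewrite -lte_fin -integral_Gamma.
apply: (@lt_le_trans _ _ (\int[leb]_(x in `[1%R, 2%R]) (expR (- 2%R))%:E)%E).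
  rewrite integral_cst//= lebesgue_measure_itv/= lte_fin ltr1n.
  by rewrite -EFinD -EFinM lte_fin mulr_gt0 ?expR_gt0// subr_gt0 ltr1n.
apply: (@le_trans _ _ (\int[leb]_(x in `[1%R, 2%R]) (g x)%:E)%E).
  apply: ge0_le_integral => //.
  - by apply/measurable_EFinP; exact: measurable_funTS.
  - move=> x /=; rewrite in_itv/= => /andP[x1 x2]; rewrite lee_fin.
    rewrite -[leLHS]mul1r ler_pM ?expR_ge0 ?ler_expR ?lerN2//.
    have <- : 1 `^ a = 1 :> R by rewrite powR1.
    by apply: ge0_ler_powR; rewrite ?nnegrE// ?(ltW a0)// (le_trans _ x1).
apply: ge0_subset_integral => //.
- by apply/measurable_EFinP; exact: measurable_funTS.
- by move=> x _; rewrite lee_fin.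
- by move=> x /=; rewrite !in_itv/= andbT => /andP[x1 _]; rewrite (le_trans _ x1).
Qed.

(** Substitution of s x for x in the Gamma integral. *)
Lemma laplace_powR s : 0 < s ->
  (\int[leb]_(x in `[0%R, +oo[) (x `^ a * expR (- (s * x)))%:E =
   (Gamma (a + 1) / s `^ (a + 1))%:E)%E.
Proof.
move=> s0.
have sp : 0 < s `^ (a + 1) by exact: powR_gt0.
have dF x : is_derive x 1 (fun x => s * x) s.
  by apply: is_derive_eq; rewrite /GRing.scale/=; ring.
have dFE : derive1 (fun x => s * x) = cst s.
  by apply/funext => x; rewrite derive1E; have [_ ->] := dF x.
have expRN_continuous x : expR (- y) @[y --> x] --> expR (- x).
  have := is_derive_continuous _ _ _ (is_derive_expRN 1 x).
  by under eq_fun do rewrite mul1r; rewrite mul1r.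
have g_continuous x : 0 < x -> g y @[y --> x] --> g x.
  move=> x0; apply: cvgM; last exact: expRN_continuous.
  exact: is_derive_continuous (is_derive1_powR a x0).
have := @increasing_ge0_integration_by_substitutiony R (fun x => s * x) g 0.
rewrite mulr0 integral_Gamma => H.
have {}H : ((Gamma (a + 1))%:E = \int[leb]_(x in `[0%R, +oo[)
    (s `^ (a + 1) * (x `^ a * expR (- (s * x))))%:E)%E.
  rewrite H.
  - apply: eq_integral => x; rewrite inE/= in_itv/= andbT => x0.
    rewrite dFE !fctE /g powRM// ?(ltW s0)// powRD; last first.
      by rewrite gt_eqF ?implybT// addr_gt0.
    by rewrite powRr1 ?ltW//; congr EFin; ring.
  - by move=> x y _ _ xy; rewrite ltr_pM2l.
  - by rewrite dFE => x _; exact: cst_continuous.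
  - by rewrite dFE; apply: is_cvg_cst.
  - by rewrite dFE; apply: is_cvg_cst.
  - split; first by move=> x _; have [] := dF x.
    by apply: cvg_at_right_filter; exact: is_derive_continuous (dF 0).
  - by apply: gt0_cvgMry.
  - apply/continuous_within_itvcyP; split.
      by move=> x; rewrite in_itv/= andbT => /g_continuous.
    have -> : g 0 = 0 * expR (- 0) by rewrite /g powR0 ?gt_eqF.
    by apply: cvgM; [exact: powR_cvg0|apply: cvg_at_right_filter; exact: expRN_continuous].
  - by move=> x _; exact: g0.
have gs0 x : 0 <= x `^ a * expR (- (s * x)) by rewrite mulr_ge0 ?powR_ge0 ?expR_ge0.
have mgs : measurable_fun setT (fun x => x `^ a * expR (- (s * x))).
  apply: measurable_funM; first exact: measurable_powR.
  have := measurable_pow_expR s 0.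
  by under eq_fun do rewrite expr0 mul1r.
have sE : ((s `^ (a + 1))%:E * (s `^ (a + 1))^-1%:E = 1)%E.
  by rewrite -EFinM divff// gt_eqF.
rewrite EFinM H; under [in RHS]eq_integral do rewrite EFinM.
rewrite ge0_integralZl_EFin//; last 3 first.
- by move=> x _; rewrite lee_fin.
- by apply/measurable_EFinP; exact: measurable_funTS.
- exact: ltW.
by rewrite muleC muleA [X in (X * _)%E]muleC sE mul1e.
Qed.

End gamma_function.

End exponential_integrals.

Section laplace_uniqueness.
Context {R : realType}.
Local Notation leb := (@lebesgue_measure R).

(* The polynomials [1 - (1 - z ^ m) ^ (2 ^ m)] converge on [0, 1] to the
   indicator of [z > 1/2]; at [z = expR (- (s * x))] they are combinations of
   the exponentials tested by the Laplace transform. *)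
Definition step_poly (m : nat) : {poly R} := 1 - (1 - 'X^m) ^+ (2 ^ m).

Lemma horner_step_poly m z : (step_poly m).[z] = 1 - (1 - z ^+ m) ^+ (2 ^ m).
Proof. by rewrite /step_poly !hornerE. Qed.

Lemma coef0_step_poly m : (0 < m)%N -> (step_poly m)`_0 = 0.
Proof.
by move=> m0; rewrite -horner_coef0 horner_step_poly expr0n gtn_eqF// subr0 expr1n subrr.
Qed.

Lemma step_poly_ge0 m z : 0 <= z <= 1 -> 0 <= (step_poly m).[z].
Proof.
move=> /andP[z0 z1]; rewrite horner_step_poly subr_ge0 exprn_ile1//.
  by rewrite subr_ge0 exprn_ile1.
by rewrite gerBl exprn_ge0.
Qed.

Lemma step_poly_le1 m z : 0 <= z <= 1 -> (step_poly m).[z] <= 1.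
Proof.
move=> /andP[z0 z1]; rewrite horner_step_poly gerBl exprn_ge0// subr_ge0.
by rewrite exprn_ile1.
Qed.

Lemma bernoulli_ge (n : nat) (x : R) : 0 <= x <= 1 -> 1 - n%:R * x <= (1 - x) ^+ n.
Proof.
move=> /andP[x0 x1]; elim: n => [|n IH]; first by rewrite mul0r subr0 expr0.
rewrite exprS; apply: (@le_trans _ _ ((1 - x) * (1 - n%:R * x))).
  rewrite -natr1; have : 0 <= n%:R * x * x by rewrite !mulr_ge0.
  by move: (n%:R : R) => u; nra.
by apply: ler_wpM2l => //; rewrite subr_ge0.
Qed.

(** Bernoulli's inequality with exponent 2^m; this gives the limit 0 for z < 1/2. *)
Lemma step_poly_le m z : 0 <= z <= 1 -> (step_poly m).[z] <= (2 * z) ^+ m.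
Proof.
move=> /andP[z0 z1]; rewrite horner_step_poly lerBlDr -lerBlDl.
have := bernoulli_ge (2 ^ m)%N (z ^+ m); rewrite exprn_ge0// exprn_ile1//.
by move=> /(_ isT); rewrite natrX exprMn.
Qed.

(** A dominating bound uniform in m. The factor z, that is exp(-s x), makes it integrable against a
    function with a finite Laplace transform. *)
Lemma step_poly_le2 m z : (0 < m)%N -> 0 <= z <= 1 -> (step_poly m).[z] <= 2 * z.
Proof.
move=> m0 z01; have [z2|z2] := leP 1 (2 * z).
  by rewrite (le_trans (step_poly_le1 _ _ z01)).
rewrite (le_trans (step_poly_le _ _ z01))//; case/andP: z01 => z0 _.
by rewrite -[leRHS]expr1 ler_wiXn2l// ?mulr_ge0// ltW.
Qed.

(** With u = z^m and N = 2^m, (1 - u)^N <= exp(-N u) <= 1 / (N u); this gives the limit 1 for z >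
    1/2. *)
Lemma step_poly_ge m z : 0 < z <= 1 -> 1 - ((2 * z)^-1) ^+ m <= (step_poly m).[z].
Proof.
move=> /andP[z0 z1]; rewrite horner_step_poly lerB// exprVn exprMn.
set u := z ^+ m; have u0 : 0 < u by rewrite exprn_gt0.
have u1 : u <= 1 by rewrite exprn_ile1// ltW.
apply: (@le_trans _ _ (expR (- u) ^+ (2 ^ m))).
  apply: lerXn2r; rewrite ?nnegrE ?subr_ge0 ?expR_ge0//.
  exact: expR_ge1Dx.
rewrite -expRM_natl mulrN expRN lef_pV2 ?posrE ?expR_gt0//; last first.
  by rewrite mulr_gt0// exprn_gt0.
rewrite natrX; apply: le_trans (expR_ge1Dx _).
by rewrite lerDr.
Qed.

Lemma step_poly_cvg z : 0 < z <= 1 -> z != 2^-1 ->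
  (step_poly n.+1).[z] @[n --> \oo] --> ((2^-1 < z)%R%:R : R).
Proof.
move=> z01 z2; have z01' : 0 <= z <= 1 by case/andP: z01 => /ltW ->.
have geo (x : R) : 0 <= x < 1 -> x ^+ n.+1 @[n --> \oo] --> (0 : R).
  move=> /andP[x0 x1]; under eq_fun do rewrite exprS.
  rewrite -(mulr0 x); apply: cvgM; first exact: cvg_cst.
  by apply: cvg_expr; rewrite ger0_norm.
have [z2'|z2'] := ltP.
  apply: (@squeeze_cvgr _ _ _ _ (fun n => 1 - ((2 * z)^-1) ^+ n.+1) (fun=> 1)).
  - by near=> n; rewrite step_poly_ge// step_poly_le1.
  - rewrite -[X in _ --> X]subr0; apply: cvgB; first exact: cvg_cst.
    have z2p : 1 < 2 * z by rewrite -ltr_pdivrMl// mulr1.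
    by apply: geo; rewrite invr_ge0 (ltW (lt_trans _ z2p))//= invf_lt1// (lt_trans _ z2p).
  - exact: cvg_cst.
apply: (@squeeze_cvgr _ _ _ _ (fun n => 0) (fun n => (2 * z) ^+ n.+1)).
- by near=> n; rewrite step_poly_ge0// step_poly_le.
- exact: cvg_cst.
apply: geo; case/andP: z01' => z0 _; rewrite mulr_ge0//= -ltr_pdivlMl// mulr1.
by rewrite lt_neqAle z2.
Unshelve. all: by end_near. Qed.

Let D : set (measurableTypeR R) := `[0%R, +oo[%classic.

Let mD : measurable D. Proof. exact: measurable_itv. Qed.

Definition has_laplace (f : measurableTypeR R -> R) (L : R -> R) := forall s, 0 < s ->
  (\int[leb]_(x in D) (f x * expR (- (s * x)))%:E = (L s)%:E)%E.

Section one_function.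
Variables (f : measurableTypeR R -> R) (L : R -> R).
Hypotheses (mf : measurable_fun setT f) (f0 : forall x, 0 <= f x).
Hypothesis fL : has_laplace f L.

Let m_expRN s : measurable_fun setT (fun x : measurableTypeR R => expR (- (s * x))).
Proof.
have := measurable_pow_expR s 0.
by under eq_fun do rewrite expr0 mul1r.
Qed.

Let int_exp s : 0 < s -> leb.-integrable D (fun x => (f x * expR (- (s * x)))%:E).
Proof.
move=> s0; apply/integrableP; split.
  by apply/measurable_EFinP; apply: measurable_funTS; exact: (measurable_funM mf (m_expRN s)).
rewrite [ltLHS](_ : _ = (L s)%:E) ?ltry// -fL//; apply: eq_integral => x _.
by rewrite gee0_abs// lee_fin mulr_ge0 ?expR_ge0.
Qed.

(** The monomial z^i tests the transform at i s. A constant term would test it at 0, where f may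
    fail to be integrable. *)
Lemma laplace_poly s (p : {poly R}) : 0 < s -> p`_0 = 0 ->
  leb.-integrable D (fun x => (p.[expR (- (s * x))] * f x)%:E) /\
  Rintegral leb D (fun x => p.[expR (- (s * x))] * f x) =
  \sum_(i < size p) p`_i * L (i%:R * s).
Proof.
move=> s0 p0.
pose t (i : nat) x := p`_i * (f x * expR (- (i%:R * s * x))).
have it i : leb.-integrable D (EFin \o t i).
  case: i => [|i].
    rewrite /t p0 (_ : _ \o _ = cst 0%E); first exact: integrable0.
    by apply/funext => x; rewrite /= mul0r.
  have i0 : 0 < i.+1%:R * s by rewrite mulr_gt0.
  have := integrableZl mD p`_i.+1 (int_exp _ i0).
  by apply: eq_integrable => // x _; rewrite /t/= EFinM.
have E x : p.[expR (- (s * x))] * f x = \sum_(i < size p) t i x.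
  rewrite horner_coef mulr_suml; apply: eq_bigr => i _.
  by rewrite -expRM_natl /t -mulrA; congr (_ * _); rewrite mulrC mulrN mulrA.
split.
  have := @integrable_sum _ _ _ leb _ mD _ (index_enum _) xpredT _
      (fun (i : 'I_(size p)) _ => it i).
  by apply: eq_integrable => // x _; rewrite E sumEFin.
under eq_Rintegral do rewrite E.
rewrite /Rintegral; under eq_integral do rewrite -sumEFin.
rewrite (@integral_sum _ _ _ leb _ mD _ (fun (i : 'I_(size p)) x => (t i x)%:E)
  (fun i => it i)).
rewrite -sum_fine; last by move=> i _; exact: (integrable_fin_num mD (it i)).
apply: eq_bigr => i _; case: (posnP i) => [->|i0].
  rewrite p0 mul0r -[RHS]/(fine 0%E); congr fine.
  by apply: integral0_eq => x _; rewrite /t p0 mul0r.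
rewrite -[LHS]/(Rintegral leb D (t i)) RintegralZl//; last first.
  by apply: int_exp; rewrite mulr_gt0// ltr0n.
by rewrite /Rintegral fL// mulr_gt0// ltr0n.
Qed.

(** The integral of f over [0, a[ is a limit of expressions in L alone, hence is determined by the
    transform. *)
Lemma laplace_initial (a : R) : 0 < a ->
  leb.-integrable (`[0%R, a[ : set R) (EFin \o f) /\
  (\sum_(i < size (step_poly n.+1)) (step_poly n.+1)`_i * L (i%:R * (ln 2 / a)))
     @[n --> \oo] --> Rintegral leb (`[0%R, a[ : set R) f.
Proof.
(* With this s, exp(-s x) exceeds 1/2 exactly when x < a. The exceptional value 1/2 of the step
   polynomials is met only at x = a, a null set. *)
move=> a0; pose s := ln 2 / a; have s0 : 0 < s by rewrite divr_gt0// ln_gt0// ltr1n.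
pose y x := expR (- (s * x)).
have y01 x : D x -> 0 < y x <= 1.
  rewrite /D/= in_itv/= andbT => x0; rewrite expR_gt0/= -expR0 ler_expR oppr_le0.
  by rewrite mulr_ge0// ltW.
have y01' x : D x -> 0 <= y x <= 1 by move=> /y01/andP[/ltW -> ->].
pose fn n (x : measurableTypeR R) : \bar R := ((step_poly n.+1).[y x] * f x)%:E.
pose A : set (measurableTypeR R) := `]-oo, a[%classic.
have mA : measurable A by exact: measurable_itv.
pose g (x : measurableTypeR R) : \bar R := (f x * \1_A x)%:E.
have mfn n : measurable_fun D (fn n).
  exact: measurable_int (laplace_poly s _ s0 (coef0_step_poly n.+1 isT)).1.
have mg : measurable_fun D g.
  apply/measurable_EFinP; apply: measurable_funTS.
  exact: (measurable_funM mf (measurable_indic mA)).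
have half : 2^-1 = expR (- (s * a)).
  by rewrite expRN /s divfK ?gt_eqF// lnK// posrE.
have yE x : (2^-1 < y x) = (x < a).
  by rewrite half /y ltr_expR ltrN2 ltr_pM2l.
have fng : {ae leb, forall x, D x -> fn n x @[n --> \oo] --> g x}.
  exists [set a]; split => //; first exact: lebesgue_measure_set1.
  move=> x /=; apply: contra_notP => /eqP xa Dx.
  have -> : g x = ((2^-1 < y x)%R%:R * f x)%:E.
    by rewrite /g yE mulrC indicE /A mem_setE in_itv.
  apply: cvg_EFin; first by near=> n.
  apply: cvgM; last exact: cvg_cst.
  apply: step_poly_cvg; first exact: y01.
  rewrite half /y (inj_eq (@expR_inj R)) (inj_eq oppr_inj).
  by rewrite (inj_eq (mulfI _))// gt_eqF.
have ib : leb.-integrable D (fun x => (2 * (f x * y x))%:E).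
  have := integrableZl mD 2 (int_exp _ s0).
  by apply: eq_integrable => // x _; rewrite EFinM.
have dom : {ae leb, forall x n, D x -> (`|fn n x| <= (2 * (f x * y x))%:E)%E}.
  apply: aeW => x n Dx; rewrite /fn abse_EFin lee_fin normrM.
  rewrite ger0_norm ?step_poly_ge0 ?y01'// ger0_norm// mulrCA mulrC ler_wpM2l//.
  by rewrite step_poly_le2// y01'.
have [ig _ cv] := dominated_convergence mD mfn mg fng ib dom.
have DE : D `&` A = (`[0%R, a[%classic : set (measurableTypeR R)).
  apply/seteqP; split => x; rewrite /D/A/= !in_itv/= ?andbT.
    by move=> [-> ->].
  by move=> /andP[].
have gE : g = (EFin \o f) \_ A.
  apply/funext => x; rewrite /g patchE indicE; case: ifP => _.
    by rewrite mulr1.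
  by rewrite mulr0.
split.
  by rewrite -DE; apply/(integrable_restrict leb mA mD); rewrite -gE.
have -> : (fun n => \sum_(i < size (step_poly n.+1)) (step_poly n.+1)`_i * L (i%:R * s)) =
  (fun n => fine (\int[leb]_(x in D) fn n x)%E).
  apply/funext => n; rewrite -(laplace_poly s _ s0 (coef0_step_poly n.+1 isT)).2.
  by [].
rewrite /Rintegral -DE integral_mkcondr -gE.
apply: fine_cvg; rewrite fineK; first exact: cv.
exact: (integrable_fin_num mD ig).
Unshelve. all: by end_near. Qed.

End one_function.
(** Both functions have the same integral over [a, b[, and monotonicity gives (b - a) f(a) <= int f
    = int h <= (b - a) h(b). *)
Lemma laplace_unique_le (f h : measurableTypeR R -> R) (L : R -> R) :
  {homo f : x y / x <= y} -> {homo h : x y / x <= y} ->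
  (forall x, 0 <= f x) -> (forall x, 0 <= h x) ->
  has_laplace f L -> has_laplace h L ->
  forall a b : R, 0 <= a -> a < b -> f a <= h b.
Proof.
move=> ndf ndh f0 h0 fL hL a b a0 ab.
have mf : measurable_fun setT f by exact: nondecreasing_measurable.
have mh : measurable_fun setT h by exact: nondecreasing_measurable.
have init c : 0 < c -> Rintegral leb (`[0%R, c[ : set R) f =
                       Rintegral leb (`[0%R, c[ : set R) h.
  move=> c0; have [_ cf] := laplace_initial f L mf f0 fL c c0.
  have [_ ch] := laplace_initial h L mh h0 hL c c0.
  exact: (cvg_unique (@Rhausdorff R) cf ch).
have b0 : 0 < b by exact: le_lt_trans ab.
have [fi _] := laplace_initial f L mf f0 fL b b0.
have [hi _] := laplace_initial h L mh h0 hL b b0.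
pose B : set (measurableTypeR R) := `[a, b[%classic.
have mB : measurable B by exact: measurable_itv.
have mI c : measurable (`[0%R, c[%classic : set (measurableTypeR R)).
  exact: measurable_itv.
have UE : (`[0%R, b[%classic : set (measurableTypeR R)) = `[0%R, a[%classic `|` B.
  apply/seteqP; split => x; rewrite /B/= !in_itv/=.
    by move=> /andP[x0 xb]; have [xa|xa] := ltP x a; [left|right]; rewrite ?x0 ?xa.
  move=> [/andP[-> xa]|/andP[xa ->]]; rewrite ?andbT/= ?(lt_trans xa)//.
  by rewrite (le_trans a0).
have disj : [disjoint (`[0%R, a[%classic : set (measurableTypeR R)) & B].
  apply/disj_setPS => x [/=]; rewrite /B/= !in_itv/= => /andP[_ xa] /andP[ax _].
  by move: xa; rewrite ltNge ax.
have int_B (g : measurableTypeR R -> R) :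
    leb.-integrable (`[0%R, b[ : set R) (EFin \o g) -> leb.-integrable B (EFin \o g).
  by apply: integrableS => //; rewrite UE; right.
have split_int (g : measurableTypeR R -> R) :
    leb.-integrable (`[0%R, b[ : set R) (EFin \o g) ->
    Rintegral leb (`[0%R, b[ : set R) g =
    Rintegral leb (`[0%R, a[ : set R) g + Rintegral leb B g.
  by move=> gi; rewrite UE Rintegral_setU//; rewrite -UE.
have BE : Rintegral leb B f = Rintegral leb B h.
  have := init b b0; rewrite !split_int//.
  suff -> : Rintegral leb (`[0%R, a[ : set R) f =
            Rintegral leb (`[0%R, a[ : set R) h by move=> /addrI.
  move: a0; rewrite le_eqVlt => /predU1P[<-|]; last exact: init.
  by rewrite set_itv_ge ?bnd_simp// !Rintegral_set0.
have lebBE : leb B = (b - a)%:E by rewrite /B lebesgue_measure_itv/= lte_fin ab.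
have lebB : fine (leb B) = b - a by rewrite lebBE.
have cst_int (c : R) : Rintegral leb B (cst c) = c * (b - a).
  by rewrite Rintegral_cst// lebB.
have cst_i (c : R) : leb.-integrable B (EFin \o cst c).
  apply: measurable_bounded_integrable => //.
    by rewrite [X in (X < _)%E](_ : _ = (b - a)%:E) ?ltry.
  exact: bounded_cst.
have ba0 : 0 < b - a by rewrite subr_gt0.
rewrite -(ler_pM2r ba0) -!cst_int.
apply: (@le_trans _ _ (Rintegral leb B f)).
  apply: (le_Rintegral mB (cst_i (f a)) (int_B f fi)).
  by move=> x; rewrite /B/= in_itv/= => /andP[ax _]; exact: ndf.
rewrite BE; apply: (le_Rintegral mB (int_B h hi) (cst_i (h b))).
by move=> x; rewrite /B/= in_itv/= => /andP[_ /ltW xb]; exact: ndh.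
Qed.

End laplace_uniqueness.

(** * Inverse stable subordinators *)

Section inverse_subordinator_paths.
Context d (T : measurableType d) (R : realType).
Variable D : R -> T -> R.
Hypotheses (mD : is_process D) (rcD : right_continuous_paths D).
Hypothesis monoD : forall w s t, 0 <= s -> s <= t -> D s w <= D t w.

Local Notation Y := (inverse_process D).

Let above t w := [set x : R | 0 <= x /\ t < D x w].

Let above_lb t w : lbound (above t w) 0.
Proof. by move=> x []. Qed.

Let above_has_lb t w : has_lbound (above t w).
Proof. by exists 0; exact: above_lb. Qed.

Lemma inverse_process_ge0 t w : 0 <= Y t w.
Proof.
have [A0|/set0P/negP/negPn/eqP A0] := pselect (above t w !=set0).
  by apply: lb_le_inf => //; exact: above_lb.
by rewrite /inverse_process -/(above t w) A0 inf0.
Qed.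

Lemma inverse_process_le t w x : 0 <= x -> t < D x w -> Y t w <= x.
Proof. by move=> x0 tx; apply: ge_inf => //; exact: above_has_lb. Qed.

(** The existence hypothesis excludes the default value 0 of [inf] on the empty set. *)
Lemma inverse_process_gt t w x : (exists y, above t w y) -> Y t w < x -> t < D x w.
Proof.
move=> A0 /(inf_lt A0)[y [y0 ty] yx].
by apply: (lt_le_trans ty); apply: monoD => //; exact: ltW.
Qed.

Lemma inverse_process_lt t w x : 0 <= x -> x < Y t w -> D x w <= t.
Proof.
by move=> x0 xY; rewrite leNgt; apply/negP => /(inverse_process_le _ _ _ x0); rewrite leNgt xY.
Qed.

Lemma inverse_process_homo t t' w : (exists y, above t' w y) ->
  t <= t' -> Y t w <= Y t' w.
Proof.
move=> A0 tt'; apply: lb_le_inf => // x [x0 xt'].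
by apply: inverse_process_le => //; exact: le_lt_trans xt'.
Qed.

(** A point x with t < D x still satisfies u < D x for u slightly above t. The lower bound is
    recorded too: since Y u approaches Y t from above, composition with a process that is merely
    right-continuous stays right-continuous. *)
Lemma inverse_process_right_near t w e : 0 < e ->
  \forall u \near t^'+, Y t w <= Y u w < Y t w + e.
Proof.
move=> e0; have [A0|/set0P/negP/negPn/eqP A0] := pselect (above t w !=set0); last first.
  have AE u : t <= u -> above u w = set0.
    move=> tu; rewrite -subset0 -A0 => x [x0 ux]; split => //.
    exact: le_lt_trans ux.
  near=> u; have tu : t <= u by near: u; exact: nbhs_right_ge.
  by rewrite /inverse_process -/(above t w) -/(above u w) !AE// inf0 lexx add0r.
have : Y t w < Y t w + e by rewrite ltrDl.
move=> /(inf_lt A0)[x [x0 tx] xY].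
near=> u.
have tu : t <= u by near: u; exact: nbhs_right_ge.
have ux : u < D x w by near: u; exact: nbhs_right_lt.
apply/andP; split; first by apply: inverse_process_homo => //; exists x.
by apply: le_lt_trans xY; exact: inverse_process_le.
Unshelve. all: by end_near. Qed.

Lemma inverse_process_right_continuous : right_continuous_paths Y.
Proof.
move=> w t _; apply/cvgrPdist_lt => e e0.
have := inverse_process_right_near t w e e0; apply: filterS => u /andP[h1 h2].
by rewrite distrC ger0_norm ?subr_ge0// ltrBlDl.
Qed.

Lemma time_change_inverse_right_continuous (X : R -> T -> R) :
  right_continuous_paths X -> right_continuous_paths (time_change X Y).
Proof.
move=> rcX w t t0; apply/cvgrPdist_lt => e e0.
have /cvgrPdist_lt/(_ e e0)[del /= del0 H] := rcX w _ (inverse_process_ge0 t w).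
have := inverse_process_right_near t w del del0; apply: filterS => u /andP[h1 h2].
rewrite /time_change; move: h1; rewrite le_eqVlt => /predU1P[<-|h1].
  by rewrite subrr normr0.
by apply: H => //=; rewrite distrC gtr0_norm ?subr_gt0// ltrBlDl.
Qed.

Lemma inverse_process_measurable : is_process Y.
Proof.
move=> t _ mT; apply: (measurability _ (RGenInftyO.measurableE R)) => //.
move=> _ [_ [a ->] <-]; rewrite setTI.
have mge x : 0 <= x -> measurable [set w | t < D x w].
  move=> x0; rewrite (_ : [set _ | _] = D x @^-1` `]t, +oo[%classic).
    by rewrite -[X in measurable X]setTI; apply: mD => //; exact: measurable_itv.
  by apply/seteqP; split => w; rewrite /= in_itv/= andbT.
have [a0|a0] := leP a 0.
  rewrite (_ : _ @^-1` _ = set0)//; apply/seteqP; split => // w /=.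
  rewrite in_itv/= => /(lt_le_trans)/(_ a0).
  by rewrite ltNge inverse_process_ge0.
(* By monotonicity of D a rational witness below a suffices. The second set consists of the paths
   that never exceed t, for which the infimum takes its default value 0 < a. *)
rewrite (_ : _ @^-1` _ =
  (\bigcup_(q : rat) (if 0 <= (ratr q : R) < a then [set w | t < D (ratr q) w] else set0))
  `|` ~` (\bigcup_n [set w | t < D n%:R w])).
  apply: measurableU.
    apply: bigcupT_measurable_rat => q; case: ifP => // /andP[q0 _].
    exact: mge.
  by apply: measurableC; apply: bigcupT_measurable => n; exact: mge.
apply/seteqP; split => w /=; rewrite in_itv/=.
  move=> Ya; have [A0|nA0] := pselect (exists y, above t w y).
    left; have /(inf_lt A0)[x [x0 tx] xa] := Ya.
    have [q] := rat_in_itvoo xa; rewrite in_itv/= => /andP[xq qa].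
    exists q => //; rewrite (le_trans x0 (ltW xq)) qa/=.
    by apply: (lt_le_trans tx); apply: monoD => //; exact: ltW.
  by right => -[n _ /= tn]; apply: nA0; exists n%:R; split.
move=> [[q _]|nA].
  case: ifP => // /andP[q0 qa] /= tq.
  by apply: le_lt_trans qa; exact: inverse_process_le.
rewrite /inverse_process (_ : [set _ | _] = set0) ?inf0//.
apply/seteqP; split => // x [x0 tx]; apply: nA.
exists (Num.truncn x).+1 => //=; apply: (lt_le_trans tx); apply: monoD => //.
by apply: ltW; exact: truncnS_gt.
Qed.

End inverse_subordinator_paths.

Section inverse_stable_moments.
Context d (T : measurableType d) (R : realType) (P : probability T R).
Variables (alpha : R) (D : R -> T -> R).
Hypotheses (alpha0 : 0 < alpha) (D_stable : is_stable_subordinator P alpha D).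
Local Notation leb := (@lebesgue_measure R).
Local Notation Y := (inverse_process D).

Let mD : is_process D. Proof. by case: D_stable => -[]. Qed.

Let rcD : right_continuous_paths D.
Proof. by case: D_stable => -[_ []]. Qed.

Let monoD w s t : 0 <= s -> s <= t -> D s w <= D t w.
Proof. by case: D_stable => _ + _; apply. Qed.

Let laplaceD s t : 0 < s -> 0 <= t ->
  (\int[P]_w (expR (- (s * D t w)))%:E)%E = (expR (- (t * s `^ alpha)))%:E.
Proof.
case: D_stable => _ _ + s0 t0 => /(_ s t s0 t0); rewrite unlock mulNr => <-.
by apply: eq_integral => w _; rewrite mulNr.
Qed.

(** On such a path every level is exceeded, so the infima defining Y are taken over nonempty
    sets. *)
Let good w := D 0 w = 0 /\ forall m : nat, exists n : nat, m%:R < D n%:R w.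

Let m_le (m n : nat) : measurable [set w | D n%:R w <= m%:R].
Proof.
rewrite (_ : [set _ | _] = D n%:R @^-1` `]-oo, m%:R]%classic).
  by rewrite -[X in measurable X]setTI; apply: mD => //; exact: measurable_itv.
by apply/seteqP; split => w; rewrite /= in_itv.
Qed.

(** Markov's inequality for exp(-D_n), whose mean is exp(-n). *)
Let bounded_path_prob (m n : nat) :
  (P [set w | (D n%:R w <= m%:R)%R] <= (expR (m%:R - n%:R))%:E)%E.
Proof.
have mE : measurable_fun setT (fun w => expR (- (1 * D n%:R w))).
  apply: (measurableT_comp (@measurable_expR R)); apply: measurable_funN.
  by apply: measurable_funM => //; exact: mD.
rewrite -[X in P X]setIT -integral_indic//.
rewrite (_ : (expR _)%:E = ((expR m%:R)%:E * \int[P]_w (expR (- (1 * D n%:R w)))%:E)%E).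
  rewrite -ge0_integralZl_EFin ?expR_ge0//; last exact/measurable_EFinP.
  apply: ge0_le_integral => //.
  - by apply/measurable_EFinP; exact: measurable_indic.
  - by apply/measurable_EFinP; exact: measurable_funM.
  move=> w _; rewrite -EFinM lee_fin indicE -expRD.
  have [|_] := boolP (_ \in _); last exact: expR_ge0.
  rewrite inE /= => Dm; rewrite -[leLHS]expR0 ler_expR mul1r subr_ge0//.
by rewrite laplaceD// powR1 mulr1 -EFinM -expRD.
Qed.

Let ae_good : exists N, [/\ measurable N, P N = 0%E & forall w, ~ N w -> good w].
Proof.
have h1 : {ae P, forall w, D 0 w = 0} by case: D_stable => -[].
have h2 : {ae P, forall w, forall m : nat, exists n : nat, m%:R < D n%:R w}.
  apply: ae_foralln => m.
  exists (\bigcap_n [set w | D n%:R w <= m%:R]); split.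
  - by apply: bigcapT_measurable => n; exact: m_le.
  - apply/eqP; rewrite eq_le measure_ge0 andbT.
    apply/lee_addgt0Pr => e e0; rewrite add0e.
    pose n := (Num.truncn (m%:R - ln e)).+1.
    apply: (@le_trans _ _ (P [set w | D n%:R w <= m%:R])).
      apply: le_measure; rewrite ?inE//.
        by apply: bigcapT_measurable => i; exact: m_le.
      by move=> w; apply.
    apply: (le_trans (bounded_path_prob m n)); rewrite lee_fin.
    rewrite -[leRHS]lnK ?posrE// ler_expR lerBlDr -lerBlDl.
    by rewrite ltW// truncnS_gt.
  - move=> w /= nP n _ /=; rewrite leNgt; apply/negP => mn; apply: nP.
    by exists n.
have [N [mN N0 NP]] := filterI h1 h2.
by exists N; split => // w Nw; apply: contrapT => gw; apply/Nw/NP.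
Qed.

Let good_above w : good w -> forall t, exists y, 0 <= y /\ t < D y w.
Proof.
move=> [_ gw] t; have [n Dn] := gw (Num.truncn t).+1.
by exists n%:R; split => //; apply: lt_trans Dn; exact: truncnS_gt.
Qed.

Let good_ge0 w x : good w -> 0 <= x -> 0 <= D x w.
Proof. by move=> [D0 _] x0; rewrite -[leLHS]D0; exact: monoD. Qed.

Let cut (g : R -> R) (x : R) : R := if 0 <= x then g x else 0.

Let integral_cut (g : R -> R) :
  (\int[leb]_x (cut g x)%:E)%E = (\int[leb]_(x in `[0%R, +oo[) (g x)%:E)%E.
Proof.
rewrite [RHS]integral_mkcond; apply: eq_integral => x _.
by rewrite /cut patchE mem_setE in_itv/= andbT; case: ifP.
Qed.

Let m_cut (g : R -> R) : measurable_fun setT g -> measurable_fun setT (cut g).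
Proof.
move=> mg; apply: measurable_fun_ifT => //.
exact: measurable_fun_ler.
Qed.

Section moment.
Variable n : nat.

Let psi := cut (fun x => n.+1%:R * x ^+ n).

Let psi0 x : 0 <= psi x.
Proof. by rewrite /psi /cut; case: ifP => // x0; rewrite mulr_ge0 ?exprn_ge0. Qed.

(** The layer-cake formula for Y^(n + 1); {D_x <= t} and {x <= Y_t} can differ only at x = Y_t. *)
Let moment_path w t : good w -> 0 <= t ->
  (\int[leb]_x (psi x * (D (Num.max x 0) w <= t)%R%:R)%:E)%E = (Y t w ^+ n.+1)%:E.
Proof.
move=> gw t0.
rewrite (integral_eq_off_null _ _ _ leb [set Y t w] _
   ((fun x => (n.+1%:R * x ^+ n)%:E) \_ (`[0%R, Y t w]%classic)))//.
- rewrite -integral_mkcond integral_pow//; exact: inverse_process_ge0.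
- exact: lebesgue_measure_set1.
move=> x /= xY; rewrite patchE mem_setE in_itv/= /psi /cut.
have [x0|x0] := leP 0 x; last by rewrite mul0r.
rewrite /=; have [xlt|xlt|xE] := ltgtP x (Y t w).
- by rewrite (inverse_process_lt _ _ _ _ _ _ _ x0 xlt)// mulr1.
- have := inverse_process_gt _ _ _ _ monoD _ _ _ (good_above _ gw t) xlt.
  by rewrite ltNge => /negbTE ->; rewrite mulr0.
- by [].
Qed.

Let moment t := (\int[P]_w (Y t w ^+ n.+1)%:E)%E.

Let Ypow_ge0 t w : 0 <= Y t w ^+ n.+1.
Proof. by rewrite exprn_ge0// inverse_process_ge0. Qed.

Let mYt t : measurable_fun setT (Y (Num.max t 0)).
Proof.
by apply: inverse_process_measurable => //; rewrite le_max lexx orbT.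
Qed.

Let mYj : measurable_fun setT (fun p : measurableTypeR R * T => Y (Num.max p.1 0) p.2).
Proof.
apply: measurable_right_continuous.
  exact: inverse_process_measurable.
exact: inverse_process_right_continuous.
Qed.

Section laplace.
Variables (s : R) (s0 : 0 < s).

Let phi := cut (fun t => s * expR (- (s * t))).

Let phi0 x : 0 <= phi x.
Proof. by rewrite /phi /cut; case: ifP => // x0; rewrite mulr_ge0 ?expR_ge0// ltW. Qed.

Let phi_path w x : good w ->
  (\int[leb]_t (phi t * (D (Num.max x 0) w <= t)%R%:R)%:E)%E =
  (expR (- (s * D (Num.max x 0) w)))%:E.
Proof.
move=> gw; set y := D _ w.
have y0 : 0 <= y by apply: good_ge0; rewrite // le_max lexx orbT.
rewrite -integral_exp_tail// [RHS]integral_mkcond; apply: eq_integral => t _.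
rewrite patchE mem_setE in_itv/= andbT /phi /cut.
have [yt|yt] := leP y t; last by rewrite mulr0.
by rewrite (le_trans y0 yt) mulr1.
Qed.

Let m_phi : measurable_fun setT (phi : measurableTypeR R -> R).
Proof.
apply: m_cut; apply: measurable_funM => //.
have := measurable_pow_expR s 0.
by under eq_fun do rewrite expr0 mul1r.
Qed.

Let m_psi : measurable_fun setT (psi : measurableTypeR R -> R).
Proof. by apply: m_cut; apply: measurable_funM => //; exact: measurable_funX. Qed.

Let swap_paths w : good w ->
  (\int[leb]_t (phi t * Y (Num.max t 0) w ^+ n.+1)%:E =
   \int[leb]_x (psi x * expR (- (s * D (Num.max x 0) w)))%:E)%E.
Proof.
move=> gw.
pose f (p : measurableTypeR R * measurableTypeR R) : \bar R :=
  (phi p.1 * (psi p.2 * (D (Num.max p.2 0) w <= p.1)%R%:R))%:E.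
have mDw : measurable_fun setT (fun x : measurableTypeR R => D (Num.max x 0) w).
  apply: nondecreasing_measurable => // x y xy; apply: monoD.
    by rewrite le_max lexx orbT.
  by rewrite ge_max !le_max xy lexx orbT.
have mind : measurable_fun setT (fun p : measurableTypeR R * measurableTypeR R =>
    (D (Num.max p.2 0) w <= p.1)%R%:R : R).
  apply: (measurableT_comp (f := fun b : bool => b%:R : R)) => //.
  apply: measurable_fun_ler => //.
  exact: (measurableT_comp mDw measurable_snd).
have mf : measurable_fun setT f.
  apply/measurable_EFinP; apply: measurable_funM.
    exact: (measurableT_comp m_phi measurable_fst).
  apply: measurable_funM => //.
  exact: (measurableT_comp m_psi measurable_snd).
have f0 p : (0 <= f p)%E by rewrite lee_fin !mulr_ge0.
have mind1 t : measurable_fun setT (fun x : measurableTypeR R =>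
    (psi x * (D (Num.max x 0) w <= t)%R%:R)%:E).
  apply/measurable_EFinP; apply: measurable_funM => //.
  apply: (measurableT_comp (f := fun b : bool => b%:R : R)) => //.
  exact: measurable_fun_ler.
have mind2 x : measurable_fun setT (fun t : measurableTypeR R =>
    (phi t * (D (Num.max x 0) w <= t)%R%:R)%:E).
  apply/measurable_EFinP; apply: measurable_funM => //.
  apply: (measurableT_comp (f := fun b : bool => b%:R : R)) => //.
  exact: measurable_fun_ler.
transitivity (\int[leb]_t \int[leb]_x f (t, x))%E.
  apply: eq_integral => t _; rewrite /f /=.
  under [in RHS]eq_integral do rewrite EFinM.
  rewrite ge0_integralZl_EFin//; last by move=> x _; rewrite lee_fin mulr_ge0.
  have [t0|t0] := leP 0 t; first by rewrite moment_path// EFinM.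
  by rewrite /phi /cut leNgt t0/= mul0r mul0e.
rewrite (fubini_tonelli (m1 := leb) (m2 := leb) f mf f0).
apply: eq_integral => x _; rewrite /fubini_G /f /=.
under eq_integral do rewrite mulrCA EFinM.
rewrite ge0_integralZl_EFin//; last by move=> t _; rewrite lee_fin mulr_ge0.
by rewrite phi_path// EFinM.
Qed.

(** Expectation and dt are exchanged, then dt and dx along each good path, then dx and expectation.
    The known transform E exp(-s D_x) = exp(-x s^alpha) leaves an elementary integral in x. *)
Lemma laplace_inverse_moment :
  (\int[leb]_t ((cut (fun t => s * expR (- (s * t))) t)%:E * moment (Num.max t 0%R)))%E =
  (n.+1`!%:R / (s `^ alpha) ^+ n.+1)%:E.
Proof.
pose f (p : measurableTypeR R * T) : \bar R :=
  (phi p.1 * Y (Num.max p.1 0) p.2 ^+ n.+1)%:E.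
have mDj : measurable_fun setT (fun p : measurableTypeR R * T => D (Num.max p.1 0) p.2).
  exact: measurable_right_continuous.
have mf : measurable_fun setT f.
  apply/measurable_EFinP; apply: measurable_funM; last exact: measurable_funX.
  exact: (measurableT_comp m_phi measurable_fst).
have f0 p : (0 <= f p)%E by rewrite lee_fin mulr_ge0.
transitivity (\int[leb]_t \int[P]_w f (t, w))%E.
  apply: eq_integral => t _; rewrite /f /=.
  under [in RHS]eq_integral do rewrite EFinM.
  rewrite ge0_integralZl_EFin//; last by apply/measurable_EFinP; exact: measurable_funX.
  by move=> w _; rewrite lee_fin.
rewrite (fubini_tonelli (m1 := leb) (m2 := P) f mf f0) /fubini_G.
pose g (p : measurableTypeR R * T) : \bar R :=
  (psi p.1 * expR (- (s * D (Num.max p.1 0) p.2)))%:E.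
have mg : measurable_fun setT g.
  apply/measurable_EFinP; apply: measurable_funM.
    exact: (measurableT_comp m_psi measurable_fst).
  apply: (measurableT_comp (@measurable_expR R)); apply: measurable_funN.
  exact: measurable_funM.
have g0 p : (0 <= g p)%E by rewrite lee_fin mulr_ge0 ?expR_ge0.
have [N [mN N0 NP]] := ae_good.
rewrite (integral_eq_off_null _ _ _ P N _ (fun w => (\int[leb]_x g (x, w))%E))//; last first.
  by move=> w Nw; rewrite /f /g /= swap_paths//; exact: NP.
rewrite -(fubini_tonelli (m1 := leb) (m2 := P) g mg g0) /fubini_F.
transitivity (\int[leb]_x (cut (fun x => n.+1%:R * (x ^+ n * expR (- (s `^ alpha * x)))) x)%:E)%E.
  apply: eq_integral => x _; rewrite /g /=.
  under eq_integral do rewrite EFinM.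
  rewrite ge0_integralZl_EFin//; last first.
    apply/measurable_EFinP; apply: (measurableT_comp (@measurable_expR R)).
    apply: measurable_funN; apply: measurable_funM => //; apply: mD.
    by rewrite le_max lexx orbT.
  rewrite laplaceD//; last by rewrite le_max lexx orbT.
  rewrite -EFinM /psi /cut; have [x0|x0] := leP 0 x; last by rewrite mul0r.
  by rewrite mulrA [s `^ _ * _]mulrC.
have sa0 : 0 < s `^ alpha by exact: powR_gt0.
rewrite integral_cut; under eq_integral do rewrite EFinM.
rewrite ge0_integralZl_EFin//; last 2 first.
- by move=> x /=; rewrite in_itv/= andbT => x0; rewrite lee_fin mulr_ge0 ?exprn_ge0 ?expR_ge0.
- by apply/measurable_EFinP; apply: measurable_funTS; exact: measurable_pow_expR.
by rewrite integral_pow_exp// -EFinM factS natrM mulrA.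
Qed.

End laplace.

Let moment_ge0 t : (0 <= moment t)%E.
Proof. by apply: integral_ge0 => w _; rewrite lee_fin. Qed.

Let moment_homo t t' : 0 <= t -> t <= t' -> (moment t <= moment t')%E.
Proof.
move=> t0 tt'; apply: ae_ge0_le_integral => //.
- by move=> w _; rewrite lee_fin.
- apply/measurable_EFinP/measurable_funX.
  by apply: inverse_process_measurable.
- by move=> w _; rewrite lee_fin.
- apply/measurable_EFinP/measurable_funX.
  by apply: inverse_process_measurable => //; exact: le_trans tt'.
have [N [mN N0 NP]] := ae_good.
exists N; split => // w /=; apply: contra_notP => Nw _.
rewrite lee_fin lerXn2r ?nnegrE ?inverse_process_ge0//.
by apply: inverse_process_homo => //; apply: good_above; exact: NP.
Qed.

Let m_moment : measurable_fun setT (fun t : measurableTypeR R => moment (Num.max t 0)).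
Proof.
pose f (p : measurableTypeR R * T) : \bar R := (Y (Num.max p.1 0) p.2 ^+ n.+1)%:E.
have mf : measurable_fun setT f.
  by apply/measurable_EFinP; exact: measurable_funX.
have f0 p : (0 <= f p)%E by rewrite lee_fin.
exact: (measurable_fun_fubini_tonelli_F (m2 := P) f mf f0).
Qed.

(** By monotonicity exp(-t0) times the moment at t0 is at most the transform at s = 1, which is
    finite. *)
Let moment_fin t0 : 0 <= t0 -> moment t0 \is a fin_num.
Proof.
move=> t00; rewrite ge0_fin_numE// ltey; apply/negP => /eqP my.
have mE : measurable_fun setT (fun x : measurableTypeR R => expR (- (1 * x))).
  have := @measurable_pow_expR R 1 0.
  by under eq_fun do rewrite expr0 mul1r.
pose e1 (t : measurableTypeR R) : R := if t0 <= t then 1 * expR (- (1 * t)) else 0.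
have me1 : measurable_fun setT e1.
  apply: measurable_fun_ifT => //; first exact: measurable_fun_ler.
  exact: measurable_funM.
have e10 t : 0 <= e1 t by rewrite /e1; case: ifP => // _; rewrite mul1r expR_ge0.
have e1E : (\int[leb]_t (e1 t)%:E = (expR (- (1 * t0)))%:E)%E.
  rewrite -integral_exp_tail// [RHS]integral_mkcond; apply: eq_integral => t _.
  by rewrite patchE mem_setE in_itv/= andbT /e1; case: ifP.
have : ((expR (- (1 * t0)))%:E * moment t0 <=
    (n.+1`!%:R / (1 `^ alpha) ^+ n.+1)%:E)%E.
  have me1E : measurable_fun setT (fun t => (e1 t)%:E) by exact/measurable_EFinP.
  have e10E t : setT t -> (0 <= (e1 t)%:E)%E by move=> _; rewrite lee_fin.
  have L1 := laplace_inverse_moment 1 ltr01.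
  rewrite -L1 -e1E.
  rewrite -(ge0_integralZr _ measurableT me1E e10E (moment_ge0 t0)).
  apply: ge0_le_integral => //.
  - by move=> t _; rewrite mule_ge0 ?lee_fin.
  - apply: emeasurable_funM; [exact/measurable_EFinP|exact: measurable_cst].
  - apply: emeasurable_funM => //; apply/measurable_EFinP; apply: m_cut.
    exact: measurable_funM.
  move=> t _; rewrite /e1 /cut.
  have [tt0|tt0] := leP t0 t.
    rewrite (le_trans t00 tt0) (max_l (le_trans t00 tt0)).
    by rewrite lee_wpmul2l ?lee_fin ?mul1r ?expR_ge0//; exact: moment_homo.
  rewrite mul0e; apply: mule_ge0 => //; rewrite lee_fin.
  by case: ifP => // _; rewrite mul1r expR_ge0.
by rewrite my gt0_muley ?lte_fin ?expR_gt0.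
Qed.

Let f (t : measurableTypeR R) : R := fine (moment (Num.max t 0)).

Let max0 (t : R) : 0 <= Num.max t 0.
Proof. by rewrite le_max lexx orbT. Qed.

Let a := n.+1%:R * alpha.

Let a0 : 0 < a.
Proof. by rewrite mulr_gt0. Qed.

Let h (t : measurableTypeR R) : R :=
  n.+1`!%:R / Gamma (a + 1) * Num.max t 0 `^ a.

Let L (s : R) : R := n.+1`!%:R / (s `^ alpha) ^+ n.+1 / s.

Let f_laplace : has_laplace f L.
Proof.
move=> s s0.
have mE : measurable_fun setT (fun x : measurableTypeR R => expR (- (s * x))).
  have := measurable_pow_expR s 0.
  by under eq_fun do rewrite expr0 mul1r.
have H : (s%:E * \int[leb]_(x in `[0%R, +oo[) (f x * expR (- (s * x)))%:E =
    (n.+1`!%:R / (s `^ alpha) ^+ n.+1)%:E)%E.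
  rewrite -laplace_inverse_moment// -ge0_integralZl_EFin//; last 3 first.
  - by move=> x _; rewrite lee_fin mulr_ge0 ?expR_ge0// fine_ge0.
  - apply/measurable_EFinP; apply: measurable_funTS; apply: measurable_funM => //.
    exact: (measurableT_comp (fine_measurable measurableT)).
  - exact: ltW.
  rewrite -(integral_cut (fun x => s * (f x * expR (- (s * x))))).
  apply: eq_integral => t _; rewrite -(fineK (moment_fin _ (max0 t))) -/(f t) -EFinM.
  rewrite /cut; case: ifP => _; last by rewrite mul0r.
  by congr EFin; ring.
have sV : (s^-1%:E * s%:E = 1)%E by rewrite -EFinM mulVf// gt_eqF.
rewrite /L -[LHS]mul1e -sV -muleA H -EFinM; congr EFin.
by rewrite mulrC.
Qed.

Let h_laplace : has_laplace h L.
Proof.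
move=> s s0; have G0 := Gamma_gt0 a a0.
transitivity (\int[leb]_(x in `[0%R, +oo[)
  ((n.+1`!%:R / Gamma (a + 1))%:E * (x `^ a * expR (- (s * x)))%:E))%E.
  apply: eq_integral => x; rewrite inE/= in_itv/= andbT => x0.
  by rewrite -EFinM /h max_l// mulrA.
rewrite ge0_integralZl_EFin//; last 3 first.
- by move=> x _; rewrite lee_fin mulr_ge0 ?powR_ge0 ?expR_ge0.
- apply/measurable_EFinP; apply: measurable_funTS.
  apply: measurable_funM; first exact: measurable_powR.
  have := measurable_pow_expR s 0.
  by under eq_fun do rewrite expr0 mul1r.
- by rewrite divr_ge0// ltW.
rewrite laplace_powR// -EFinM; congr EFin; rewrite /L.
have sa : s `^ (a + 1) = (s `^ alpha) ^+ n.+1 * s.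
  rewrite powRD; last by rewrite (gt_eqF s0) implybT.
  by rewrite powRr1 ?(ltW s0)// /a [_%:R * _]mulrC powRrM powR_mulrn// powR_ge0.
have sp : (s `^ alpha) ^+ n.+1 != 0 by rewrite expf_neq0// gt_eqF// powR_gt0.
rewrite sa; move: ((s `^ alpha) ^+ n.+1) sp => u u0.
by field; rewrite u0 !gt_eqF.
Qed.

Let f_homo : {homo f : x y / x <= y}.
Proof.
move=> x y xy; apply: fine_le; rewrite ?moment_fin//.
by apply: moment_homo => //; rewrite ge_max !le_max xy lexx orbT.
Qed.

Let h_homo : {homo h : x y / x <= y}.
Proof.
move=> x y xy; apply: ler_wpM2l; first by rewrite divr_ge0// ltW// Gamma_gt0.
by apply: ge0_ler_powR; rewrite ?nnegrE ?(ltW a0)// ge_max !le_max xy lexx orbT.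
Qed.

Let f_ge0 x : 0 <= f x. Proof. exact: fine_ge0. Qed.

Let h_ge0 x : 0 <= h x.
Proof. by rewrite mulr_ge0 ?powR_ge0// divr_ge0// ltW// Gamma_gt0. Qed.

Let h_cvg (u : R^nat) (t : R) : 0 <= t -> (forall n, 0 <= u n) ->
  u n @[n --> \oo] --> t -> h (u n) @[n --> \oo] --> h t.
Proof.
move=> t0 u0 ut; apply: cvgM; first exact: cvg_cst.
under eq_fun do rewrite max_l//; rewrite max_l//.
(* Differentiability of the power yields continuity at t > 0. At 0 the bound u < e^(1/a) gives u^a <
   e directly. *)
move: t0; rewrite le_eqVlt => /predU1P[t0|t0]; last first.
  apply: (cvg_comp u (fun x => x `^ a) ut).
  exact: is_derive_continuous (is_derive1_powR a t0).
rewrite -t0 powR0 ?gt_eqF//; apply/cvgrPdist_lt => e e0.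
have ea : 0 < e `^ a^-1 by exact: powR_gt0.
move/cvgrPdist_lt : ut => /(_ _ ea); apply: filterS => m.
rewrite -t0 !sub0r !normrN ger0_norm// ger0_norm ?powR_ge0// => um.
rewrite -[ltRHS]powRr1 ?(ltW e0)//.
rewrite [X in _ < _ `^ X](_ : 1 = a^-1 * a); last by rewrite mulVf// gt_eqF.
rewrite [ltRHS]powRrM.
by apply: gt0_ltr_powR => //; rewrite nnegrE// ltW.
Qed.

Lemma inverse_stable_moment t : 0 <= t ->
  (\int[P]_w (Y t w ^+ n.+1)%:E)%E =
  (n.+1`!%:R / Gamma (n.+1%:R * alpha + 1) * t `^ (n.+1%:R * alpha))%:E.
Proof.
move=> t0; rewrite -[LHS]fineK ?moment_fin//; congr EFin.
rewrite -/a -[in LHS](max_l t0) -[in RHS](max_l t0) -/(moment _) -/(f t) -/(h t).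
have fh := laplace_unique_le f h L f_homo h_homo f_ge0 h_ge0 f_laplace h_laplace.
have hf := laplace_unique_le h f L h_homo f_homo h_ge0 f_ge0 h_laplace f_laplace.
(* Uniqueness only compares values at distinct times, so f(t) is squeezed between values of the
   continuous function h on either side of t. *)
apply/eqP; rewrite eq_le; apply/andP; split.
  apply: (cvgn_ge (fun m => h (t + harmonic m))).
    apply: h_cvg => //; first by move=> m; rewrite addr_ge0 ?harmonic_ge0.
    rewrite -[X in _ --> X]addr0; apply: cvgD; first exact: cvg_cst.
    exact: cvg_harmonic.
  by move=> m; apply: fh => //; rewrite ltrDl harmonic_gt0.
have [t1|t1] : 0 = t \/ 0 < t by apply/predU1P; rewrite -le_eqVlt.
  rewrite -t1.
  by rewrite {1}/h maxxx powR0 ?gt_eqF// mulr0.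
(* The perturbation is proportional to t, which keeps the earlier time nonnegative. *)
apply: (cvgn_le (fun m => h (t - t * harmonic m))).
  apply: h_cvg => //.
    move=> m; rewrite -[X in X - _]mulr1 -mulrBr mulr_ge0 ?(ltW t1)// subr_ge0.
    by rewrite invf_le1// ler1n.
  rewrite -[X in _ --> X]subr0; apply: cvgB; first exact: cvg_cst.
  rewrite -(mulr0 t); apply: cvgM; first exact: cvg_cst.
  exact: cvg_harmonic.
move=> m; apply: hf.
  rewrite -[X in X - _]mulr1 -mulrBr mulr_ge0 ?(ltW t1)// subr_ge0.
  by rewrite invf_le1// ler1n.
by rewrite gtrDl oppr_lt0 mulr_gt0// harmonic_gt0.
Qed.

End moment.
End inverse_stable_moments.

(** * Fractional processes and time changes *)

Section time_change_moments.
Context d (T : measurableType d) (R : realType) (P : probability T R).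
Variables (X : R -> T -> R) (tau : T -> R) (r N : nat).
Variables (base : nat -> R -> R) (c c' : nat -> R).
Hypotheses (mX : is_process X) (rcX : right_continuous_paths X).
Hypothesis mtau : measurable_fun setT tau.
Hypothesis indep : forall A B, process_sigma_algebra X A -> measurable B ->
  P (A `&` tau @^-1` B) = (P A * P (tau @^-1` B))%E.
Hypothesis int_X : forall t, 0 <= t -> P.-integrable setT (fun w => (gbinom (X t w) r)%:E).
Hypothesis momX : forall t, 0 <= t ->
  Rintegral P setT (fun w => gbinom (X t w) r) = \sum_(n < N) base n t * c n.
Hypothesis absX : forall t, 0 <= t ->
  Rintegral P setT (fun w => `|gbinom (X t w) r|) <= \sum_(n < N) base n t * c' n.
Hypothesis int_base : forall n,
  P.-integrable setT (fun w => (base n (Num.max (tau w) 0))%:E).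

Local Notation tau0 w := (Num.max (tau w) 0).

Let tau0_ge0 w : 0 <= tau0 w. Proof. by rewrite le_max lexx orbT. Qed.

Let int_sum (e : nat -> R) :
  P.-integrable setT (fun w => (\sum_(n < N) base n (tau0 w) * e n)%:E).
Proof.
have ie (n : 'I_N) : P.-integrable setT (fun w => (base n (tau0 w) * e n)%:E).
  have := integrableZl measurableT (e n) (int_base n).
  by apply: eq_integrable => // w _; rewrite EFinM muleC.
have := @integrable_sum _ _ _ P _ measurableT _ (index_enum _) xpredT _
  (fun (n : 'I_N) _ => ie n).
by apply: eq_integrable => // w _; rewrite sumEFin.
Qed.

Let Rint_sum (e : nat -> R) :
  Rintegral P setT (fun w => \sum_(n < N) base n (tau0 w) * e n) =
  \sum_(n < N) Rintegral P setT (fun w => base n (tau0 w)) * e n.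
Proof.
rewrite Rintegral_sum.
  by apply: eq_bigr => n _; rewrite (RintegralZr (e n) measurableT (int_base n)).
move=> n; have := integrableZl measurableT (e n) (int_base n).
by apply: eq_integrable => // w _; rewrite /= EFinM muleC.
Qed.

Let int_norm t : 0 <= t -> P.-integrable setT (fun w => `|gbinom (X t w) r|%:E).
Proof. by move=> t0; exact: (integrable_norm (int_X t t0)). Qed.

(** The domination that justifies Fubini, supplied by the bound on absolute moments at fixed
    times. *)
Let inner_abs : (\int[P]_w \int[P]_w' `|gbinom (X (tau0 w) w') r|%:E <=
  (\sum_(n < N) Rintegral P setT (fun w => base n (tau0 w)) * c' n)%:E)%E.
Proof.
rewrite -Rint_sum /Rintegral fineK; last exact: integrable_fin_num.
apply: ge0_le_integral => //.
- by move=> w _; apply: integral_ge0.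
- exact: (random_time_measurable_inner _ _ _ P _ _ mX rcX mtau (fun x => gbinom x r)
    (measurable_gbinom R r)).
- exact: measurable_int (int_sum c').
move=> w _; have := absX _ (tau0_ge0 w); rewrite -lee_fin; apply: le_trans.
by rewrite /Rintegral fineK//; exact: (integrable_fin_num measurableT (int_norm _ (tau0_ge0 w))).
Qed.

(** The base functions are arbitrary so that the lemma serves for both time changes. The absolute
    bound comes out in the shape of the hypothesis [absX], so the result of the first application
    feeds the second. *)
Lemma time_change_binomial_moment :
  [/\ P.-integrable setT (fun w => (gbinom (X (tau0 w) w) r)%:E),
      Rintegral P setT (fun w => gbinom (X (tau0 w) w) r) =
        \sum_(n < N) Rintegral P setT (fun w => base n (tau0 w)) * c n &
      Rintegral P setT (fun w => `|gbinom (X (tau0 w) w) r|) <=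
        \sum_(n < N) Rintegral P setT (fun w => base n (tau0 w)) * c' n].
Proof.
have mg := measurable_gbinom R r.
have mgn : measurable_fun setT (fun x : R => `|gbinom x r|).
  exact: measurableT_comp.
have lt1 := le_lt_trans inner_abs (ltry _).
have [i1 E1] := random_time_fubini _ _ _ P _ _ mX rcX mtau indep _ mg lt1.
have lt2 : (\int[P]_w \int[P]_w' `| `|gbinom (X (tau0 w) w') r| |%:E < +oo)%E.
  by under eq_integral do under eq_integral do rewrite normr_id.
have [i2 E2] := random_time_fubini _ _ _ P _ _ mX rcX mtau indep _ mgn lt2.
split => //.
  rewrite -Rint_sum /Rintegral E1; congr fine; apply: eq_integral => w _.
  rewrite -momX// /Rintegral fineK//.
  exact: (integrable_fin_num measurableT (int_X _ (tau0_ge0 w))).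
rewrite -lee_fin {1}/Rintegral fineK; first by rewrite E2.
exact: (integrable_fin_num measurableT i2).
Qed.

End time_change_moments.

Section gfsp_moments.
Context d (T : measurableType d) (R : realType) (P : probability T R).
Context (k : nat) (lambda mu : 'I_k -> R).

Lemma gsp_process (X : R -> T -> R) : is_GSP P lambda mu X ->
  is_process X /\ right_continuous_paths X.
Proof.
move=> [M1 [M2 [[[mM1 [rc1 _] _ _ _] _ _] [[mM2 [rc2 _] _ _ _] _ _] _ XE]]].
split => [t t0|w t t0].
  apply: (eq_measurable_fun (fun w => M1 t w - M2 t w)).
    by move=> w _; rewrite XE.
  by apply: measurable_funB; [exact: mM1|exact: mM2].
rewrite XE//.
apply: (cvg_trans _ (cvgB (rc1 w t t0) (rc2 w t t0))).
apply: near_eq_cvg; near=> u; rewrite /= XE//.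
by rewrite (le_trans t0)//; near: u; exact: nbhs_right_ge.
Unshelve. all: by end_near. Qed.

(** For r > 0 the zeroth power has no coefficient of degree r. Starting at exponent 1 matches the
    moments of positive order available for the random times. *)
Lemma gsp_binomial_moment_shift (X : R -> T -> R) r t :
  is_GSP P lambda mu X -> (0 < r)%N -> 0 <= t ->
  [/\ P.-integrable setT (fun w => (gbinom (X t w) r)%:E),
      Rintegral P setT (fun w => gbinom (X t w) r) =
        \sum_(n < r) t ^+ n.+1 / n.+1`!%:R * (gsp_poly R k lambda mu r ^+ n.+1)`_r &
      Rintegral P setT (fun w => `|gbinom (X t w) r|) <=
        \sum_(n < r) t ^+ n.+1 / n.+1`!%:R * (gsp_abs_poly R k lambda mu r ^+ n.+1)`_r].
Proof.
move=> X_gsp r0 t0.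
have [h1 h2 h3] := gsp_binomial_moment _ _ _ _ _ _ _ _ X_gsp r t t0.
have drop0 (C : {poly R}) : \sum_(m < r.+1) t ^+ m / m`!%:R * (C ^+ m)`_r =
    \sum_(n < r) t ^+ n.+1 / n.+1`!%:R * (C ^+ n.+1)`_r.
  by rewrite big_ord_recl expr0 coef1 gtn_eqF// mulr0 add0r.
by split; rewrite -?drop0.
Qed.

Lemma Gamma_natS n : Gamma (n.+1%:R + 1 : R) = n.+1`!%:R.
Proof.
apply: EFin_inj; rewrite -integral_Gamma//.
transitivity (\int[@lebesgue_measure R]_(x in `[0%R, +oo[)
    (x ^+ n.+1 * expR (- (1 * x)))%:E)%E.
  apply: eq_integral => x; rewrite inE/= in_itv/= andbT => x0.
  by rewrite powR_mulrn// mul1r.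
by rewrite integral_pow_exp// expr1n divr1.
Qed.

(** The terms of the Mittag-Leffler series of order alpha at t^alpha, without the constant one; for
    alpha = 1 they are t^(n + 1) / (n + 1)!. *)
Definition frac_base (alpha : R) (n : nat) (t : R) : R :=
  t `^ (n.+1%:R * alpha) / Gamma (n.+1%:R * alpha + 1).

Lemma gfsp_binomial_moment (alpha : R) (X : R -> T -> R) (r : nat) :
  0 < alpha -> alpha <= 1 -> is_GFSP P alpha lambda mu X -> (0 < r)%N ->
  [/\ is_process X, right_continuous_paths X &
   forall t, 0 <= t ->
   [/\ P.-integrable setT (fun w => (gbinom (X t w) r)%:E),
      Rintegral P setT (fun w => gbinom (X t w) r) =
        \sum_(n < r) frac_base alpha n t * (gsp_poly R k lambda mu r ^+ n.+1)`_r &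
      Rintegral P setT (fun w => `|gbinom (X t w) r|) <=
        \sum_(n < r) frac_base alpha n t * (gsp_abs_poly R k lambda mu r ^+ n.+1)`_r]].
Proof.
move=> a0 a1; rewrite /is_GFSP; case: ltP => [alt1|age1] + r0; last first.
  have -> : alpha = 1 by apply/eqP; rewrite eq_le a1.
  move=> X_gsp; have [mX rcX] := gsp_process _ X_gsp.
  split => // t t0; have [h1 h2 h3] := gsp_binomial_moment_shift _ _ _ X_gsp r0 t0.
  have bE n : frac_base 1 n t = t ^+ n.+1 / n.+1`!%:R.
    by rewrite /frac_base !mulr1 Gamma_natS powR_mulrn.
  by split => //; under eq_bigr do rewrite bE.
move=> [S [D [S_gsp D_stable ind XE]]].
have [mS rcS] := gsp_process _ S_gsp.
have mD : is_process D by case: D_stable => -[].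
have monoD w s t : 0 <= s -> s <= t -> D s w <= D t w by case: D_stable => _ + _; apply.
pose Y := inverse_process D.
have mY : is_process Y by exact: inverse_process_measurable.
have Y0 t w : 0 <= Y t w by exact: inverse_process_ge0.
have YE t w : Num.max (Y t w) 0 = Y t w by rewrite max_l.
have mX : is_process X.
  move=> t t0; apply: (eq_measurable_fun (fun w => S (Num.max (Y t w) 0) w)).
    by move=> w _; rewrite XE// YE.
  by apply: measurable_random_time => //; exact: mY.
have rcX : right_continuous_paths X.
  move=> w t t0; rewrite XE//.
  have := time_change_inverse_right_continuous _ _ _ D S rcS w t t0.
  apply: cvg_trans; apply: near_eq_cvg; near=> u; rewrite XE//.
  by rewrite (le_trans t0)//; near: u; exact: nbhs_right_ge.
split => // t t0.
have Ymom n := inverse_stable_moment _ _ _ P _ _ a0 D_stable n t t0.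
have Yint n : P.-integrable setT (fun w => (Y t w ^+ n.+1)%:E).
  apply/integrableP; split.
    by apply/measurable_EFinP; apply: measurable_funX; exact: mY.
  under eq_integral do rewrite gee0_abs ?lee_fin ?exprn_ge0//.
  by rewrite Ymom ltry.
pose base n (x : R) : R := x ^+ n.+1 / n.+1`!%:R.
have int_base n : P.-integrable setT (fun w => (base n (Num.max (Y t w) 0))%:E).
  have := integrableZl measurableT (n.+1`!%:R^-1) (Yint n).
  by apply: eq_integrable => // w _; rewrite YE /base mulrC EFinM.
have baseE n : Rintegral P setT (fun w => base n (Num.max (Y t w) 0)) =
    frac_base alpha n t.
  under eq_Rintegral do rewrite YE /base.
  rewrite (RintegralZr _ measurableT (Yint n)) /Rintegral Ymom /= /frac_base.
  rewrite mulrC mulrA mulrA mulVf ?factr_neq0// mul1r.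
  by rewrite mulrC.
have indY A B : process_sigma_algebra S A -> measurable B ->
    P (A `&` Y t @^-1` B) = (P A * P (Y t @^-1` B))%E.
  move=> SA mB; apply: ind => //; apply: sub_sigma_algebra.
  by exists t, B.
have shift u := gsp_binomial_moment_shift S r u S_gsp r0.
have := time_change_binomial_moment _ _ _ P S (Y t) r r base
  (fun n => (gsp_poly R k lambda mu r ^+ n.+1)`_r)
  (fun n => (gsp_abs_poly R k lambda mu r ^+ n.+1)`_r) mS rcS (mY t t0) indY
  (fun u u0 => let: And3 h _ _ := shift u u0 in h)
  (fun u u0 => let: And3 _ h _ := shift u u0 in h)
  (fun u u0 => let: And3 _ _ h := shift u u0 in h) int_base.
have XE' w : S (Num.max (Y t w) 0) w = X t w by rewrite XE// YE.
under eq_fun do rewrite XE'.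
under eq_Rintegral do rewrite XE'.
under [X in X <= _]eq_Rintegral do rewrite XE'.
under eq_bigr do rewrite baseE.
by under [X in _ <= X]eq_bigr do rewrite baseE.
Unshelve. all: by end_near. Qed.

End gfsp_moments.

Lemma gsp_rateE (R : realType) (k : nat) (lambda mu : 'I_k -> R) (m : nat) :
  gsp_rate R k lambda mu m = m`!%:R^-1 * \sum_(i < k)
    ((i.+1 ^_ m)%:R * lambda i +
     (-1) ^+ m * (rising_factorial i.+1 m)%:R * mu i).
Proof.
rewrite /gsp_rate -big_split/= mulr_sumr; apply: eq_bigr => i _.
by rewrite /gbinom falling_nat falling_opp_nat; ring.
Qed.

Theorem proposition3p1 (d : measure_display) (T : measurableType d)
  (R : realType) (P : probability T R)
  (k : nat) (lambda mu : 'I_k -> R) (alpha : R) (f : R -> R)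
  (S D : R -> T -> R)
  (k_ge1 : (1 <= k)%N)
  (lambda_gt0 : forall i, 0 < lambda i)
  (mu_gt0 : forall i, 0 < mu i)
  (alpha_gt0 : 0 < alpha) (alpha_le1 : alpha <= 1)
  (S_gfsp : is_GFSP P alpha lambda mu S)
  (D_sub : is_subordinator P f D)
  (D_moments : forall t p : R, 0 <= t -> 0 < p ->
     ('E_P[fun w => (D t w `^ p)%R] < +oo)%E)
  (S_D_indep : independent_processes P S D)
  (t : R) (t_ge0 : 0 <= t) (r : nat) (r_ge1 : (1 <= r)%N) :
  ('E_P[fun w => real_falling_factorial (time_change S D t w) r] =
   (r`!%:R : R)%:E * \sum_(1 <= n < r.+1)
     ('E_P[fun w => (D t w `^ (n%:R * alpha))%R] *
      ((Gamma (n%:R * alpha + 1))^-1 *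
       \sum_(m : {ffun 'I_n -> 'I_r.+1} |
               (\sum_(l < n) m l == r)%N && [forall l, (0 < m l)%N])
         \prod_(l < n)
           ((m l)`!%:R^-1 *
            \sum_(i < k)
              ((i.+1 ^_ m l)%:R * lambda i
               + (-1) ^+ m l * (rising_factorial i.+1 (m l))%:R * mu i)))%:E))%E.
Proof.
have mD u : 0 <= u -> measurable_fun setT (D u) by case: D_sub => -[+ _ _ _ _] _ _; apply.
(* Monotone paths give D t >= D 0, but D 0 = 0 holds only almost surely. *)
have [N [mN N0 D_ge0]] : exists N : set T, [/\ measurable N, P N = 0%E &
    forall w, ~ N w -> 0 <= D t w].
  case: D_sub => -[_ _ [N [mN N0 NP]] _ _] mono _.
  exists N; split => // w Nw.
  have D0 : D 0 w = 0 by apply: contrapT => D0; exact/Nw/NP.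
  by rewrite -D0; exact: mono.
have tauE w : ~ N w -> Num.max (D t w) 0 = D t w.
  by move=> Nw; rewrite max_l// D_ge0.
have [mS rcS momS] := gfsp_binomial_moment _ _ _ _ _ _ _ _ _ _
  alpha_gt0 alpha_le1 S_gfsp r_ge1.
have indD A B : process_sigma_algebra S A -> measurable B ->
    P (A `&` D t @^-1` B) = (P A * P (D t @^-1` B))%E.
  move=> SA mB; apply: S_D_indep => //; apply: sub_sigma_algebra.
  by exists t, B.
have powE p : 'E_P[fun w => (D t w `^ p)%R]%E =
    (\int[P]_w (Num.max (D t w) 0 `^ p)%:E)%E.
  rewrite unlock; apply: (integral_eq_off_null _ _ _ _ N) => // w Nw.
  by rewrite tauE.
have int_pow p : 0 < p -> P.-integrable setT (fun w => (Num.max (D t w) 0 `^ p)%:E).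
  move=> p0; apply/integrableP; split.
    apply/measurable_EFinP; apply: (measurableT_comp (measurable_powR _)).
    by apply: measurable_maxr => //; exact: mD.
  under eq_integral do rewrite gee0_abs ?lee_fin ?powR_ge0//.
  by rewrite -powE; exact: D_moments.
have p_gt0 n : 0 < n.+1%:R * alpha by rewrite mulr_gt0.
have int_base n : P.-integrable setT (fun w => (frac_base R alpha n (Num.max (D t w) 0))%:E).
  have := integrableZl measurableT ((Gamma (n.+1%:R * alpha + 1))^-1) (int_pow _ (p_gt0 n)).
  by apply: eq_integrable => // w _; rewrite /frac_base EFinM muleC.
have [intZ momZ _] := time_change_binomial_moment _ _ _ P S (D t) r r
  (frac_base R alpha) (fun n => (gsp_poly R k lambda mu r ^+ n.+1)`_r)
  (fun n => (gsp_abs_poly R k lambda mu r ^+ n.+1)`_r) mS rcS (mD t t_ge0) indD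
  (fun u u0 => let: And3 h _ _ := momS u u0 in h)
  (fun u u0 => let: And3 _ h _ := momS u u0 in h)
  (fun u u0 => let: And3 _ _ h := momS u u0 in h) int_base.
(* On the null set S may be evaluated at a negative time, where its measurability is unknown;
   [integral_eq_off_null] replaces the integrand without assuming it. *)
have -> : 'E_P[fun w => real_falling_factorial (time_change S D t w) r]%E =
    (r`!%:R * Rintegral P setT (fun w => gbinom (S (Num.max (D t w) 0) w) r))%:E.
  rewrite -(RintegralZl _ measurableT intZ) /Rintegral fineK; last first.
    apply: integrable_fin_num => //.
    have := integrableZl measurableT (r`!%:R) intZ.
    by apply: eq_integrable => // w _; rewrite /= EFinM.
  rewrite unlock; apply: (integral_eq_off_null _ _ _ _ N) => // w Nw.
  by rewrite tauE// /gbinom mulrCA mulfV ?mulr1// factr_neq0.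
rewrite momZ EFinM big_add1/= big_mkord -sumEFin; congr (_ * _)%E.
apply: eq_bigr => n _; rewrite powE /frac_base.
rewrite (RintegralZr _ measurableT (int_pow _ (p_gt0 n))) -mulrA EFinM.
rewrite /Rintegral fineK; last exact: integrable_fin_num (int_pow _ (p_gt0 n)).
congr (_ * (_ * _)%:E)%E; rewrite /gsp_poly coef_exp_compositions.
by apply: eq_bigr => m _; apply: eq_bigr => l _; rewrite gsp_rateE.
Qed.
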